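(* Let $b<c$ be integers of the same parity, and write $\delta=(b-c)^2/4=2^t\Omega^2$ with $t\geq 0$ even and $\Omega\geq 1$ odd. Assume $\sigma_{-1}(\Omega)\leq 4/3$. Let $c^*=\max(1,c+1)$, $f(n)=(n-b)(n-c)$ and $X=\sqrt{f(N)}$. Then for every integer $N\geq c^*$, \[\sum_{c^*\leq n\leq N}\tau\big((n-b)(n-c)\big)< 2N\Big(\frac{3}{\pi^2}\log^2 X+\Big(\frac{6}{\pi^2}+C(\Omega)\Big)\log X+C(\Omega)\Big)+2X\Big(\frac{6}{\pi^2}\log X+C(\Omega)\Big),\] where \[C(\Omega)=2\sum_{d\mid\Omega}\frac1d\Big(2\sigma_0(\Omega/d)-1.749\,\sigma_{-1}(\Omega/d)+1.332\Big).\]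
   Context: $\tau(m)$ is the number of positive divisors of $m$; $\sigma_a(q)=\sum_{d\mid q}d^a$ (sum over positive divisors), so $\sigma_0$ counts divisors and $\sigma_{-1}(q)=\sum_{d\mid q}1/d$. *)

(* Defs.v *)
From Stdlib Require Import Reals ZArith List Lia Lra.
Import ListNotations.
Open Scope R_scope.

(* positive divisors of q (meaningful for q >= 1; empty for q <= 0) *)
Definition divs (q : Z) : list Z :=
  filter (fun d => Z.eqb (Z.modulo q d) 0)
         (map Z.of_nat (seq 1 (Z.to_nat q))).

Definition tau (m : Z) : nat := length (divs (Z.abs m)).

Definition sigma0 (q : Z) : R := INR (length (divs q)).

Definition sigma_m1 (q : Z) : R :=
  fold_right Rplus 0 (map (fun d => / IZR d) (divs q)).

Definition C_Omega (Om : Z) : R :=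
  2 * fold_right Rplus 0
        (map (fun d => / IZR d *
                 (2 * sigma0 (Z.div Om d) - (1749/1000) * sigma_m1 (Z.div Om d)
                  + 1332/1000))
             (divs Om)).

Definition Zsum (a N : Z) (g : Z -> nat) : nat :=
  fold_right Nat.add 0%nat
    (map (fun k => g (a + Z.of_nat k)%Z) (seq 0 (Z.to_nat (N - a + 1)))).

(* Main.v *)
(** Write M = c - b, X^2 = f(N), and let rho(d) be the number of residues x
    modulo d with d | x (x + M). Pairing each divisor of f(n) with its cofactor
    bounds the divisor sum by 2 sum_(d <= X) rho(d) (N / d + 1), so everything
    follows from S(X) = sum_(d <= X) rho(d) <= X ((6 / pi^2) ln X + C') with
    C' < C(Omega), and an Abel summation for sum rho(d) / d.

    If g is the largest divisor of M with g^2 | d, the roots modulo d are the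
    multiples of g lying over the roots of y (y + M / g) modulo d / g^2, and such
    a root is determined by the squarefree number l whose primes are those
    dividing both y and d / g^2; moreover d / (g^2 l) is coprime to M / g. Hence
    S(X) is at most the sum over g | M of g times the number of pairs (l, k) with
    l squarefree, k coprime to M / g and g^2 l k <= X. Counting k produces
    phi(M / g) / (M / g) up to an error governed by the odd part of M / g, and
    the main terms add up because sum_(g | M) phi(M / g) = M.

    The remaining sum of 1 / l over squarefree l <= n is at most
    (6 / pi^2) ln n + 2.165: writing every k <= n as d^2 l gives first the lower
    bound (6 / pi^2) ln (n + 1), and, fed back into the same decomposition, the
    upper bound. The value zeta(2) = pi^2 / 6 comes from
    sum_(0 < k < 2^j) 1 / sin^2 (k pi / 2^j) = (4^j - 1) / 3. *)

Require Import Defs.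
From Stdlib Require Import Reals ZArith List Lra Lia.
From HB Require Import structures.
From mathcomp Require Import all_boot cyclic zify_ssreflect.
Set Implicit Arguments.
Unset Strict Implicit.
Unset Printing Implicit Defensive.
Open Scope R_scope.

(** * Finite sums of reals *)


HB.instance Definition _ := Monoid.isComLaw.Build R 0 Rplus
  (fun x y z => esym (Rplus_assoc x y z)) Rplus_comm Rplus_0_l.
HB.instance Definition _ := Monoid.isMulLaw.Build R 0 Rmult Rmult_0_l Rmult_0_r.
HB.instance Definition _ := Monoid.isAddLaw.Build R Rmult Rplus
  Rmult_plus_distr_r Rmult_plus_distr_l.

Notation "\sum_ ( i <- r ) F" := (\big[Rplus/0]_(i <- r) F) : R_scope.
Notation "\sum_ ( i <- r | P ) F" := (\big[Rplus/0]_(i <- r | P%B) F) : R_scope.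
Notation "\sum_ ( m <= i < n ) F" :=
  (\big[Rplus/0]_(m%N <= i < n%N) F) : R_scope.
Notation "\sum_ ( m <= i < n | P ) F" :=
  (\big[Rplus/0]_(m%N <= i < n%N | P%B) F) : R_scope.

Lemma INR_addn m n : INR (m + n)%N = INR m + INR n.
Proof. by rewrite -plusE plus_INR. Qed.

Lemma INR_muln m n : INR (m * n)%N = INR m * INR n.
Proof. by rewrite -multE mult_INR. Qed.

Lemma INR_leq m n : (m <= n)%N -> INR m <= INR n.
Proof. by move=> /leP; exact: le_INR. Qed.

Lemma INR_gt0 n : (0 < n)%N -> 0 < INR n.
Proof. by move=> /ltP; exact: lt_0_INR. Qed.

Lemma INR_ge1 n : (0 < n)%N -> 1 <= INR n.
Proof. exact: (@INR_leq 1). Qed.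

Lemma INR_divn m n : (0 < n)%N -> INR (m %/ n)%N <= INR m / INR n.
Proof.
move=> n0; apply: (Rmult_le_reg_r (INR n)); first exact: INR_gt0.
rewrite -INR_muln /Rdiv Rmult_assoc Rinv_l ?Rmult_1_r; last first.
  by have := INR_gt0 n0; lra.
exact/INR_leq/leq_divM.
Qed.

Lemma INR_dvdn m n : (n %| m)%N -> (0 < n)%N -> INR (m %/ n)%N = INR m / INR n.
Proof.
move=> nm n0; have := INR_gt0 n0 => ?.
rewrite -{2}(divnK nm) INR_muln; field; lra.
Qed.

Lemma INR_sum (I : Type) (r : seq I) (P : pred I) (F : I -> nat) :
  INR (\sum_(i <- r | P i) F i)%N = \sum_(i <- r | P i) INR (F i).
Proof. by apply: (big_morph INR INR_addn). Qed.

Section RealSums.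
Variables (I : eqType).
Implicit Types (r : seq I) (P : pred I) (F G : I -> R).

Lemma ler_sum r P F G : (forall i, i \in r -> P i -> F i <= G i) ->
  \sum_(i <- r | P i) F i <= \sum_(i <- r | P i) G i.
Proof.
move=> h; rewrite big_seq_cond [X in _ <= X]big_seq_cond.
elim/big_ind2 : _ => [|*|i /andP[]]; [lra|lra|exact: h].
Qed.

Lemma sum_ge0 r P F : (forall i, i \in r -> P i -> 0 <= F i) ->
  0 <= \sum_(i <- r | P i) F i.
Proof.
move=> h; rewrite big_seq_cond.
elim/big_ind : _ => [|*|i /andP[]]; [lra|lra|exact: h].
Qed.

(** Each element of [s] is removed once from [t], and what remains of [t] has a nonnegative sum.
    Factorisation arguments become inequalities between sums in this way. *)
Lemma ler_sum_sub (s t : seq I) F : uniq s -> {subset s <= t} ->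
  (forall i, i \in t -> 0 <= F i) -> \sum_(i <- s) F i <= \sum_(i <- t) F i.
Proof.
elim: s t => [|x s IH] t /=; first by rewrite big_nil => _ _ F0; apply: sum_ge0 => i + _; exact: F0.
move=> /andP[xs us] st F0; have xt : x \in t by apply: st; rewrite mem_head.
rewrite big_cons (perm_big _ (perm_to_rem xt)) big_cons.
apply: Rplus_le_compat_l; apply: IH => // [i si|i /mem_rem]; last exact: F0.
have : i \in t by apply: st; rewrite inE si orbT.
rewrite (perm_mem (perm_to_rem xt)) inE => /orP[/eqP ix|//].
by rewrite -ix si in xs.
Qed.

Lemma ler_sum_cond r P F : (forall i, i \in r -> 0 <= F i) ->
  \sum_(i <- r | P i) F i <= \sum_(i <- r) F i.
Proof.
move=> F0; rewrite big_mkcond; apply: ler_sum => i ir _.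
by case: ifP => _; [lra|exact: F0].
Qed.

End RealSums.

Lemma sum_const_nat n (x : R) : \sum_(1 <= i < n.+1) x = INR n * x.
Proof.
elim: n => [|n IH]; first by rewrite big_geq // Rmult_0_l.
by rewrite big_nat_recr // IH S_INR /=; ring.
Qed.

Section NatSums.
Variables (T : Type) (idx : T) (op : Monoid.com_law idx).

Lemma big_multiples (r n : nat) (F : nat -> T) : (0 < r)%N ->
  \big[op/idx]_(1 <= d < n.+1 | (r %| d)%N) F d
  = \big[op/idx]_(1 <= k < (n %/ r).+1) F (r * k)%N.
Proof.
move=> r0; rewrite -big_filter -(big_map (muln r) xpredT).
apply: perm_big; apply: uniq_perm.
- exact/filter_uniq/iota_uniq.
- rewrite map_inj_uniq ?iota_uniq // => a b /eqP.
  by rewrite eqn_pmul2l // => /eqP.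
move=> d; rewrite mem_filter mem_index_iota; apply/idP/mapP.
  case/and3P => /dvdnP[k ->] d0 dn; exists k; last by rewrite mulnC.
  rewrite mem_index_iota; move: d0; rewrite muln_gt0 => /andP[-> _] /=.
  by rewrite ltnS leq_divRL // -ltnS.
case=> k; rewrite mem_index_iota => /andP[k0]; rewrite ltnS leq_divRL // => kn ->.
by rewrite dvdn_mulr //= muln_gt0 r0 k0 /= ltnS mulnC.
Qed.

(** Moving the window from [a] to [a + 1] drops [F a] and gains [F (a + d)], which is equal. *)
Lemma big_periodic_shift d a (F : nat -> T) : (forall k, F (k + d)%N = F k) ->
  \big[op/idx]_(0 <= k < d) F (a + k)%N = \big[op/idx]_(0 <= k < d) F k.
Proof.
move=> Fd; elim: a => [|a <-]; first by apply: eq_bigr.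
case: d Fd => [|d] Fd; first by rewrite !big_geq.
rewrite big_nat_recr // [RHS]big_nat_recl //= addn0 addSnnS Fd Monoid.mulmC.
by congr (op _ _); apply: eq_bigr => k _; rewrite addSnnS.
Qed.

End NatSums.

Lemma sum_periodic_mul d n (F : nat -> nat) : (forall k, F (k + d) = F k)%N ->
  (\sum_(0 <= k < n * d) F k = n * \sum_(0 <= k < d) F k)%N.
Proof.
move=> Fd; elim: n => [|n IH]; first by rewrite mul0n big_geq.
rewrite mulSn addnC (@big_cat_nat _ _ _ (n * d)%N) ?leq_addr //= IH.
rewrite mulSn addnC; congr addn.
rewrite -(@big_periodic_shift _ _ addn d (n * d)%N) //.
rewrite -[X in index_iota X _]add0n big_addn addKn.
by apply: eq_bigr => k _; rewrite addnC.
Qed.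

Lemma sum_periodic_le d L a (F : nat -> nat) : (0 < d)%N ->
  (forall k, F (k + d) = F k)%N ->
  (\sum_(0 <= k < L) F (a + k) <= (L %/ d).+1 * \sum_(0 <= k < d) F k)%N.
Proof.
move=> d0 Fd; rewrite -(big_periodic_shift _ a Fd).
rewrite -sum_periodic_mul => [|k]; last by rewrite addnA Fd.
rewrite [X in (_ <= X)%N](@big_cat_nat _ _ _ L) ?leq_addr //.
by rewrite ltnW // ltn_ceil.
Qed.

Lemma sum_periodic_mul1 d n (F : nat -> nat) : (forall k, F (k + d) = F k)%N ->
  (\sum_(1 <= k < (n * d).+1) F k = n * \sum_(0 <= k < d) F k)%N.
Proof.
move=> Fd; rewrite -sum_periodic_mul // big_add1 /=.
apply: (@big_periodic_shift _ _ addn (n * d)%N 1%N F) => k.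
by elim: n => [|n IH]; rewrite ?mul0n ?addn0 // mulSn [(d + _)%N]addnC addnA Fd.
Qed.

(** * Elementary bounds for the logarithm *)

Lemma ln_le_sub1 x : 0 < x -> ln x <= x - 1.
Proof. by move=> x0; have := exp_ineq1_le (ln x); rewrite exp_ln //; lra. Qed.

Lemma ln_ge_1subV x : 0 < x -> 1 - / x <= ln x.
Proof.
move=> x0; have := ln_le_sub1 (Rinv_0_lt_compat _ x0).
by rewrite ln_Rinv //; lra.
Qed.

Lemma ln_le_mono x y : 0 < x -> x <= y -> ln x <= ln y.
Proof. by move=> x0 [/(ln_increasing _ _ x0)|->]; lra. Qed.

Lemma ln_ge0 x : 1 <= x -> 0 <= ln x.
Proof. by move=> x1; rewrite -ln_1; apply: ln_le_mono; lra. Qed.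

Lemma ln_div x y : 0 < x -> 0 < y -> ln (x / y) = ln x - ln y.
Proof.
by move=> x0 y0; rewrite ln_mult ?ln_Rinv //; exact: Rinv_0_lt_compat.
Qed.

Lemma lnS_sub_le n : (0 < n)%N -> ln (INR n.+1) - ln (INR n) <= / INR n.
Proof.
move=> n0; have n1 := INR_ge1 n0; rewrite S_INR -ln_div; try lra.
apply: Rle_trans (ln_le_sub1 _) _; first by apply: Rdiv_lt_0_compat; lra.
by apply: Req_le; field; lra.
Qed.

Lemma lnS_sub_ge n : (0 < n)%N -> / INR n.+1 <= ln (INR n.+1) - ln (INR n).
Proof.
move=> n0; have n1 := INR_ge1 n0; rewrite S_INR -ln_div; try lra.
apply: Rle_trans (ln_ge_1subV _); last by apply: Rdiv_lt_0_compat; lra.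
by apply: Req_le; field; lra.
Qed.

(** * The Basel sum *)


Lemma xcos_le_sin x : 0 < x < PI / 2 -> x * cos x <= sin x.
Proof.
move=> [x0 x2].
have [y [eq_y [y0 yx]]] := MVT_cor2 sin cos 0 x x0 (fun y _ => derivable_pt_lim_sin y).
have : cos x < cos y by apply: cos_decreasing_1; lra.
by rewrite sin_0 in eq_y; nra.
Qed.

(** This is [sin x <= x <= tan x], squared and inverted: [/ sin x ^ 2 - 1] is the squared
    cotangent. *)
Lemma inv_sqr_bounds x : 0 < x < PI / 2 ->
  / sin x ^ 2 - 1 <= / x ^ 2 <= / sin x ^ 2.
Proof.
move=> xI; have [x0 x2] := xI.
have s0 : 0 < sin x by apply: sin_gt_0; lra.
have sx := sin_lt_x _ x0; have xc := xcos_le_sin xI.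
have c0 : 0 < cos x by apply: cos_gt_0; lra.
have sc := sin2_cos2 x; rewrite /Rsqr in sc.
split.
  apply: (Rmult_le_reg_r (x ^ 2 * sin x ^ 2)).
    by apply: Rmult_lt_0_compat; exact: pow_lt.
  rewrite (_ : (/ sin x ^ 2 - 1) * _ = x ^ 2 * (1 - sin x ^ 2)); last by field; nra.
  rewrite (_ : / x ^ 2 * _ = sin x ^ 2); last by field; lra.
  rewrite (_ : 1 - sin x ^ 2 = cos x ^ 2); last by lra.
  have xc0 : 0 < x * cos x by exact: Rmult_lt_0_compat.
  by have := Rmult_le_compat _ _ _ _ (Rlt_le _ _ xc0) (Rlt_le _ _ xc0) xc xc; lra.
by apply: Rinv_le_contravar; nra.
Qed.

(** The double-angle formula together with [sin^2 + cos^2 = 1]; the cosine of [x / 2] is written as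
    a shifted sine so that both terms have the shape of [csc2]. *)
Lemma inv_sin_sqr_double x : 0 < x < PI ->
  / sin x ^ 2 = / 4 * (/ sin (x / 2) ^ 2 + / sin (x / 2 + PI / 2) ^ 2).
Proof.
move=> xI.
have s0 : 0 < sin (x / 2) by apply: sin_gt_0; lra.
have c0 : 0 < cos (x / 2) by apply: cos_gt_0; lra.
have -> : sin (x / 2 + PI / 2) = cos (x / 2) by rewrite sin_plus cos_PI2 sin_PI2; ring.
have sc := sin2_cos2 (x / 2); rewrite /Rsqr in sc.
rewrite {1}(_ : x = 2 * (x / 2)) ?sin_2a; last by field.
have -> : (2 * sin (x / 2) * cos (x / 2)) ^ 2
  = 4 * (sin (x / 2) ^ 2 * cos (x / 2) ^ 2) by ring.
have -> : / sin (x / 2) ^ 2 + / cos (x / 2) ^ 2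
  = (sin (x / 2) * sin (x / 2) + cos (x / 2) * cos (x / 2))
    * / (sin (x / 2) ^ 2 * cos (x / 2) ^ 2) by field; lra.
by rewrite sc; field; lra.
Qed.

Lemma INR_expn2 j : INR (2 ^ j)%N = 2 ^ j.
Proof. by elim: j => [|j IH]; rewrite ?expn0 // expnS INR_muln IH. Qed.

Definition csc2 (j k : nat) : R := / sin (INR k * PI / 2 ^ j) ^ 2.

(** At level [j + 1] the middle term [k = 2 ^ j] equals 1, and the terms [k] and [k + 2 ^ j] combine
    to 4 times the term [k] of level [j]: the sums satisfy S(j + 1) = 4 S(j) + 1. *)
Lemma csc2_sum j : \sum_(1 <= k < 2 ^ j) csc2 j k = (4 ^ j - 1) / 3.
Proof.
elim: j => [|j IH]; first by rewrite expn0 big_geq //=; field.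
have p0 : 0 < 2 ^ j by apply: pow_lt; lra.
have k0 : (0 < 2 ^ j)%N by rewrite expn_gt0.
rewrite expnS mul2n -addnn (@big_cat_nat _ _ _ (2 ^ j)%N) ?leq_addr //=.
rewrite [X in _ + X = _]big_ltn; last by rewrite -[X in (X < _)%N]add0n ltn_add2r.
have -> : csc2 j.+1 (2 ^ j) = 1.
  rewrite /csc2 INR_expn2 /= (_ : 2 ^ j * PI / (2 * 2 ^ j) = PI / 2); last by field; lra.
  by rewrite sin_PI2; field.
rewrite -(add1n (2 ^ j)%N) big_addn addnK.
rewrite (_ : (4 * 4 ^ j - 1) / 3 = 1 + 4 * ((4 ^ j - 1) / 3)); last by field.
rewrite -IH big_distrr /=.
rewrite Rplus_comm Rplus_assoc -big_split /= (Rplus_comm _ (\sum_(_ <= _ < _) _)) Rplus_comm.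
congr (_ + _).
rewrite !big_seq; apply: eq_bigr => k; rewrite mem_index_iota => /andP[k1 kj].
have := INR_gt0 k1 => k1'.
have kj' : INR k < 2 ^ j by rewrite -INR_expn2; apply: lt_INR; apply/ltP.
have pi0 := PI_RGT_0.
rewrite /csc2 [in RHS]inv_sin_sqr_double.
  rewrite -Rmult_assoc Rinv_r ?Rmult_1_l; try lra.
  rewrite Rplus_comm INR_addn INR_expn2 /=.
  congr (/ sin _ ^ 2 + / sin _ ^ 2); field; lra.
split; first by apply: Rdiv_lt_0_compat => //; nra.
by apply: (Rmult_lt_reg_r (2 ^ j)) => //; rewrite /Rdiv Rmult_assoc Rinv_l; nra.
Qed.

(** The reflection [x -> PI - x] exchanges the two halves of [csc2_sum] around its middle term 1.
    The lower half has its angles in [(0, PI / 2)], where [inv_sqr_bounds] applies. *)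
Lemma csc2_half_sum j :
  \sum_(1 <= k < 2 ^ j) csc2 j.+1 k = (4 ^ j.+1 - 4) / 6.
Proof.
have p0 : 0 < 2 ^ j by apply: pow_lt; lra.
have k0 : (0 < 2 ^ j)%N by rewrite expn_gt0.
have := csc2_sum j.+1.
rewrite expnS mul2n -addnn (@big_cat_nat _ _ _ (2 ^ j)%N) ?leq_addr //=.
rewrite [X in _ + X = _]big_ltn; last by rewrite -[X in (X < _)%N]add0n ltn_add2r.
have -> : csc2 j.+1 (2 ^ j) = 1.
  rewrite /csc2 INR_expn2 /= (_ : 2 ^ j * PI / (2 * 2 ^ j) = PI / 2); last by field; lra.
  by rewrite sin_PI2; field.
rewrite -(add1n (2 ^ j)%N) big_addn addnK.
rewrite [X in _ + (1 + X) = _](_ : _ = \sum_(1 <= k < 2 ^ j) csc2 j.+1 k); first lra.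
rewrite big_nat_rev /= !big_seq; apply: eq_bigr => k.
rewrite mem_index_iota => /andP[k1 kj].
rewrite /csc2 (_ : (1 + 2 ^ j - k.+1 + 2 ^ j) = 2 ^ j + 2 ^ j - k)%N; last by lia.
rewrite minus_INR; last by lia.
rewrite plus_INR !INR_expn2 /=.
rewrite (_ : (2 ^ j + 2 ^ j - INR k) * PI / (2 * 2 ^ j)
   = PI - INR k * PI / (2 * 2 ^ j)); last by field; lra.
by rewrite sin_PI_x.
Qed.

Definition zeta2 n : R := \sum_(1 <= k < n.+1) / INR k ^ 2.

Lemma zeta2_mono m n : (m <= n)%N -> zeta2 m <= zeta2 n.
Proof.
move=> mn; apply: ler_sum_sub; first exact: iota_uniq.
  by move=> k; rewrite !mem_index_iota; lia.
move=> k; rewrite mem_index_iota => /andP[/INR_gt0 k0 _].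
by apply/Rlt_le/Rinv_0_lt_compat/pow_lt.
Qed.

(** Scaling by [PI ^ 2 / 4 ^ j.+1] turns [inv_sqr_bounds] at the angles [k * PI / 2 ^ j.+1] into
    bounds on [1 / k^2]. The 1 lost per term costs at most [2 ^ j] before scaling, hence an error of
    order [1 / 2 ^ j]; the factor 2 is generous. *)
Lemma zeta2_bounds j :
  PI ^ 2 / 6 - 2 * PI ^ 2 / 2 ^ j <= zeta2 (2 ^ j).-1 <= PI ^ 2 / 6.
Proof.
have p1 : 1 <= 2 ^ j by apply: pow_R1_Rle; lra.
have k0 : (0 < 2 ^ j)%N by rewrite expn_gt0.
have pi0 := PI_RGT_0.
have e4 : 4 ^ j = 2 ^ j * 2 ^ j by rewrite -Rpow_mult_distr; congr (_ ^ _); ring.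
have -> : zeta2 (2 ^ j).-1
    = PI ^ 2 / 4 ^ j.+1 * \sum_(1 <= k < 2 ^ j) / (INR k * PI / 2 ^ j.+1) ^ 2.
  rewrite /zeta2 prednK // big_distrr /= !big_seq; apply: eq_bigr => k.
  rewrite mem_index_iota e4 => /andP[/INR_gt0 k1 _].
  by field; lra.
have B k : k \in index_iota 1 (2 ^ j) ->
    / sin (INR k * PI / 2 ^ j.+1) ^ 2 - 1 <= / (INR k * PI / 2 ^ j.+1) ^ 2
      <= / sin (INR k * PI / 2 ^ j.+1) ^ 2.
  rewrite mem_index_iota => /andP[k1 kj].
  have k1' := INR_gt0 k1.
  have kj' : INR k < 2 ^ j by rewrite -INR_expn2; apply: lt_INR; apply/ltP.
  apply: inv_sqr_bounds => /=; split; first by apply: Rdiv_lt_0_compat; nra.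
  apply: (Rmult_lt_reg_r (2 * 2 ^ j)); first lra.
  rewrite /Rdiv Rmult_assoc Rinv_l; last lra.
  by rewrite (_ : PI * / 2 * (2 * 2 ^ j) = PI * 2 ^ j); [nra|field].
have c0 : 0 < PI ^ 2 / 4 ^ j.+1.
  by apply: Rdiv_lt_0_compat; apply: pow_lt; lra.
have H := csc2_half_sum j.
split; last first.
  apply: (Rle_trans _ (PI ^ 2 / 4 ^ j.+1 * ((4 ^ j.+1 - 4) / 6))).
    apply: Rmult_le_compat_l; first lra.
    by rewrite -H; apply: ler_sum => k /B[].
  rewrite /= e4.
  have -> : PI ^ 2 / (4 * (2 ^ j * 2 ^ j)) * ((4 * (2 ^ j * 2 ^ j) - 4) / 6)
     = PI ^ 2 / 6 - PI ^ 2 / 6 * / (2 ^ j * 2 ^ j) by field; lra.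
  have : 0 < / (2 ^ j * 2 ^ j) by apply: Rinv_0_lt_compat; nra.
  by nra.
apply: (Rle_trans _ (PI ^ 2 / 4 ^ j.+1 * ((4 ^ j.+1 - 4) / 6 - 2 ^ j))).
  rewrite /= e4.
  have -> : PI ^ 2 / (4 * (2 ^ j * 2 ^ j)) * ((4 * (2 ^ j * 2 ^ j) - 4) / 6 - 2 ^ j)
     = PI ^ 2 / 6 - PI ^ 2 / 2 ^ j * (/ 6 * / 2 ^ j + / 4) by field; lra.
  have : / 2 ^ j <= 1 by rewrite -Rinv_1; apply: Rinv_le_contravar; lra.
  have : 0 < PI ^ 2 / 2 ^ j by apply: Rdiv_lt_0_compat; nra.
  have -> : 2 * PI ^ 2 / 2 ^ j = PI ^ 2 / 2 ^ j * 2 by field; lra.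
  by nra.
apply: Rmult_le_compat_l; first lra.
rewrite -H; apply: (Rle_trans _ (\sum_(1 <= k < 2 ^ j) (csc2 j.+1 k - 1))).
  rewrite -{2}(prednK k0).
  have -> : \sum_(1 <= k < (2 ^ j).-1.+1) (csc2 j.+1 k - 1) =
    \sum_(1 <= k < (2 ^ j).-1.+1) csc2 j.+1 k + \sum_(1 <= k < (2 ^ j).-1.+1) (-1).
    by rewrite -big_split.
  rewrite sum_const_nat prednK //.
  have : INR (2 ^ j).-1 <= 2 ^ j by rewrite -INR_expn2; apply: INR_leq; lia.
  lra.
by apply: ler_sum => k /B[].
Qed.

Lemma zeta2_le n : zeta2 n <= PI ^ 2 / 6.
Proof.
apply: Rle_trans (zeta2_bounds n).2; apply: zeta2_mono.
by have := ltn_expl n (isT : (1 < 2)%N); lia.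
Qed.

Lemma zeta2_approx eps : 0 < eps -> exists n, PI ^ 2 / 6 - eps <= zeta2 n.
Proof.
move=> e0; have pi0 := PI_RGT_0.
have c0 : 0 < 2 * PI ^ 2 / eps by apply: Rdiv_lt_0_compat; nra.
have [j hj] := INR_unbounded (2 * PI ^ 2 / eps).
exists (2 ^ j).-1; apply: Rle_trans _ (zeta2_bounds j).1.
have jp : INR j <= 2 ^ j by rewrite -INR_expn2; apply/INR_leq/ltnW/ltn_expl.
suff : 2 * PI ^ 2 / 2 ^ j <= eps by lra.
apply: (Rmult_le_reg_r (2 ^ j)); first lra.
rewrite /Rdiv Rmult_assoc Rinv_l; last lra.
have -> : 2 * PI ^ 2 * 1 = 2 * PI ^ 2 / eps * eps by field; lra.
by nra.
Qed.

Lemma zeta2_limit_gt : 3 / 2 < PI ^ 2 / 6.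
Proof. by have := PI2_3_2; nra. Qed.

(** * Harmonic sums over squarefree numbers *)


(** Testing [h] in [[2, l + 1]] suffices, since [h ^ 2 %| l] with [l > 0] forces [h <= l]. *)
Definition sqfree l := ((0 < l) && all (fun h => ~~ (h ^ 2 %| l)) (iota 2 l))%N.

Lemma sqfreeP l :
  reflect (0 < l /\ forall h, h ^ 2 %| l -> h = 1)%N (sqfree l).
Proof.
apply: (iffP andP) => -[l0 H]; split=> //.
  move=> h hl; have h0 : (0 < h)%N by case: h hl => //; rewrite dvd0n; lia.
  apply/eqP; rewrite eqn_leq h0 andbT leqNgt; apply/negP => h1.
  have hle : (h <= l)%N.
    by apply: leq_trans (dvdn_leq l0 hl); rewrite -{1}[h]expn1 leq_pexp2l.
  by move: (allP H h); rewrite mem_iota hl h1 => /(_ _)/negP; apply; rewrite // !ltnS ltnW // ltnS.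
apply/allP => h; rewrite mem_iota => /andP[h2 _].
by apply/negP => /H h1; rewrite h1 in h2.
Qed.

Lemma sqfree_gt0 l : sqfree l -> (0 < l)%N.
Proof. by case/andP. Qed.

(** Take [d] maximal with [d ^ 2 %| n]: a square [h ^ 2] dividing the cofactor makes [d * h]
    admissible too, so [h = 1]. *)
Lemma sqfree_decomp n : (0 < n)%N ->
  exists d l, [/\ (0 < d)%N, sqfree l & n = (d ^ 2 * l)%N].
Proof.
move=> n0.
have exd : exists d, (d ^ 2 %| n)%N by exists 1%N.
have ubd d : (d ^ 2 %| n -> d <= n)%N.
  move=> dn; apply: leq_trans (dvdn_leq n0 dn).
  by case: d {dn} => // d; rewrite -{1}[d.+1]expn1 leq_pexp2l.
case: (ex_maxnP exd ubd) => d dn dmax.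
have d0 : (0 < d)%N by apply: (dmax 1%N).
have [l nE] := dvdnP dn.
exists d, l; split=> //; last by rewrite nE mulnC.
apply/sqfreeP; split; first by move: n0; rewrite nE muln_gt0 => /andP[].
move=> h hl.
have h0 : (0 < h)%N by case: h hl => //; rewrite dvd0n => /eqP l0; move: n0; rewrite nE l0.
have := dmax (d * h)%N; rewrite nE expnMn mulnC dvdn_pmul2r ?expn_gt0 ?d0 // => /(_ hl).
by rewrite -{2}[d]muln1 leq_pmul2l //; lia.
Qed.

(** After division by the gcd, [d1 = a * g] and [d2 = b * g] with [a], [b] coprime; then [a ^ 2]
    divides [b ^ 2 * l2], hence [l2], and [a = 1]. *)
Lemma sqr_part_dvdn d1 l1 d2 l2 : (0 < d1)%N -> sqfree l2 ->
  (d1 ^ 2 * l1 = d2 ^ 2 * l2)%N -> (d1 %| d2)%N.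
Proof.
move=> d10 /sqfreeP[_ sl2] E; pose g := gcdn d1 d2.
have g0 : (0 < g)%N by rewrite gcdn_gt0 d10.
have [a aE] := dvdnP (dvdn_gcdl d1 d2); have [b bE] := dvdnP (dvdn_gcdr d1 d2).
rewrite -/g in aE bE.
have cop : coprime a b.
  by rewrite /coprime -(eqn_pmul2r g0) mul1n muln_gcdl -aE -bE.
have a1 : a = 1%N.
  apply: sl2; rewrite -(@Gauss_dvdr _ (b ^ 2)) ?coprimeXl ?coprimeXr //.
  apply/dvdnP; exists l1; apply/eqP.
  rewrite -(@eqn_pmul2r (g ^ 2)) ?expn_gt0 ?g0 //.
  have -> : (b ^ 2 * l2 * g ^ 2 = d2 ^ 2 * l2)%N by rewrite {1}bE expnMn; lia.
  by rewrite -E {1}aE expnMn; apply/eqP; lia.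
by rewrite aE a1 mul1n dvdn_gcdr.
Qed.

Lemma sqfree_decomp_uniq d1 l1 d2 l2 : (0 < d1)%N -> (0 < d2)%N ->
  sqfree l1 -> sqfree l2 -> (d1 ^ 2 * l1 = d2 ^ 2 * l2)%N -> d1 = d2 /\ l1 = l2.
Proof.
move=> d10 d20 s1 s2 E.
have d12 : d1 = d2.
  apply/eqP; rewrite eqn_dvd (sqr_part_dvdn d10 s2 E).
  exact: (sqr_part_dvdn d20 s1 (esym E)).
split=> //; apply/eqP.
by rewrite -(@eqn_pmul2l (d1 ^ 2)) ?expn_gt0 ?d10 // E d12.
Qed.

Definition harm n : R := \sum_(1 <= k < n.+1) / INR k.
Definition sqfree_harm n : R := \sum_(1 <= l < n.+1 | sqfree l) / INR l.

Lemma harmS n : harm n.+1 = harm n + / INR n.+1.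
Proof. by rewrite /harm big_nat_recr. Qed.

Lemma inv_INR_ge0 k : (0 < k)%N -> 0 <= / INR k.
Proof. by move=> /INR_gt0/Rinv_0_lt_compat/Rlt_le. Qed.

Lemma inv_sqr_ge0 k : (0 < k)%N -> 0 <= / INR k ^ 2.
Proof. by move=> /INR_gt0 k0; apply/Rlt_le/Rinv_0_lt_compat/pow_lt. Qed.

Lemma ln_le_harm n : ln (INR n.+1) <= harm n.
Proof.
elim: n => [|n IH]; first by rewrite /harm big_geq // ln_1; lra.
by rewrite harmS; have := lnS_sub_le (ltn0Sn n); lra.
Qed.

(** The difference [harm n - ln n] decreases. Starting at 2 gives [3 / 2 - ln 2] in place of the
    constant 1, a gain on which the 2.165 of [sqfree_harm_le] depends. *)
Lemma harm_le_ln n : (1 < n)%N -> harm n <= 3 / 2 - ln 2 + ln (INR n).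
Proof.
case: n => [|[|n]] // _; elim: n => [|n IH].
  rewrite /harm 2?big_nat_recr // big_geq //= -[1 + 1]/2; lra.
by rewrite harmS; have := lnS_sub_ge (ltn0Sn n.+1); lra.
Qed.

Lemma inv_sqr_mul d l : (0 < d)%N -> (0 < l)%N ->
  / INR (d ^ 2 * l)%N = / INR d ^ 2 * / INR l.
Proof.
move=> /INR_gt0 d0 /INR_gt0 l0.
by rewrite -mulnn !INR_muln /=; field; lra.
Qed.

Lemma harm_le_sqfree n : harm n <= zeta2 n * sqfree_harm n.
Proof.
pose L := [seq l <- index_iota 1 n.+1 | sqfree l].
have -> : zeta2 n * sqfree_harm n
    = \sum_(k <- [seq (d ^ 2 * l)%N | d <- index_iota 1 n.+1, l <- L]) / INR k.
  have -> : sqfree_harm n = \sum_(l <- L) / INR l by rewrite big_filter.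
  rewrite big_allpairs_dep big_distrl /=.
  rewrite big_seq [RHS]big_seq; apply: eq_bigr => d; rewrite mem_index_iota => /andP[d0 _].
  rewrite big_distrr /= big_seq [RHS]big_seq; apply: eq_bigr => l.
  by rewrite mem_filter => /andP[/sqfree_gt0 l0 _]; rewrite inv_sqr_mul.
apply: ler_sum_sub; first exact: iota_uniq.
- move=> k; rewrite mem_index_iota => /andP[k0 kn].
  have [d [l [d0 sl kE]]] := sqfree_decomp k0.
  have l0 := sqfree_gt0 sl.
  apply/allpairsP; exists (d, l); split=> //=.
    by rewrite mem_index_iota d0; apply: leq_ltn_trans kn; rewrite kE; nia.
  rewrite mem_filter sl mem_index_iota l0.
  by apply: leq_ltn_trans kn; rewrite kE; apply: leq_pmull; rewrite expn_gt0 d0.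
- move=> k /allpairsP[[d l] /= []]; rewrite mem_filter !mem_index_iota.
  move=> /andP[d0 _] /and3P[_ l0 _] ->; apply: inv_INR_ge0.
  by rewrite muln_gt0 expn_gt0 d0.
Qed.

(** The numbers [d ^ 2 * l] with [l] squarefree and [l <= n / d ^ 2] are at most [n] and, by
    uniqueness of the decomposition, pairwise distinct. *)
Lemma sqfree_le_harm n D :
  \sum_(1 <= d < D.+1) / INR d ^ 2 * sqfree_harm (n %/ d ^ 2) <= harm n.
Proof.
pose L d := [seq l <- index_iota 1 (n %/ d ^ 2).+1 | sqfree l].
have -> : \sum_(1 <= d < D.+1) / INR d ^ 2 * sqfree_harm (n %/ d ^ 2)
    = \sum_(k <- [seq (d ^ 2 * l)%N | d <- index_iota 1 D.+1, l <- L d]) / INR k.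
  rewrite big_allpairs_dep.
  rewrite big_seq [RHS]big_seq; apply: eq_bigr => d; rewrite mem_index_iota => /andP[d0 _].
  rewrite /sqfree_harm -big_filter big_distrr /= big_seq [RHS]big_seq; apply: eq_bigr => l.
  by rewrite mem_filter => /andP[/sqfree_gt0 l0 _]; rewrite inv_sqr_mul.
apply: ler_sum_sub.
- apply: allpairs_uniq_dep => [|d _|]; first exact: iota_uniq.
    exact/filter_uniq/iota_uniq.
  move=> _ _ /allpairsPdep[d1 [l1 [d1I l1I ->]]] /allpairsPdep[d2 [l2 [d2I l2I ->]]] /=.
  move: d1I d2I l1I l2I; rewrite !mem_filter !mem_index_iota.
  move=> /andP[d10 _] /andP[d20 _] /andP[s1 _] /andP[s2 _] E.
  by have [-> ->] := sqfree_decomp_uniq d10 d20 s1 s2 E.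
- move=> k /allpairsPdep[d [l [dI lI ->]]].
  move: dI lI; rewrite mem_filter !mem_index_iota.
  move=> /andP[d0 _] /and3P[_ l0]; rewrite ltnS leq_divRL ?expn_gt0 ?d0 // => ln.
  by rewrite muln_gt0 expn_gt0 d0 l0 /= ltnS mulnC.
- by move=> k; rewrite mem_index_iota => /andP[k0 _]; exact: inv_INR_ge0.
Qed.

Lemma sqfree_harm_ge0 n : 0 <= sqfree_harm n.
Proof.
by apply: sum_ge0 => l; rewrite mem_index_iota => /andP[l0 _] _; exact: inv_INR_ge0.
Qed.

Lemma sqfree_harm_mono m n : (m <= n)%N -> sqfree_harm m <= sqfree_harm n.
Proof.
move=> mn; rewrite /sqfree_harm -big_filter -[X in _ <= X]big_filter.
apply: ler_sum_sub => [|l|l]; first exact/filter_uniq/iota_uniq.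
  by rewrite !mem_filter !mem_index_iota => /and3P[-> -> /=]; lia.
by rewrite mem_filter mem_index_iota => /and3P[_ l0 _]; exact: inv_INR_ge0.
Qed.

Lemma sqfree_harm_ge n : 6 / PI ^ 2 * ln (INR n.+1) <= sqfree_harm n.
Proof.
have z := zeta2_limit_gt.
rewrite (_ : 6 / PI ^ 2 = / (PI ^ 2 / 6)); last by field; have := PI_RGT_0; lra.
apply: (Rmult_le_reg_l (PI ^ 2 / 6)); first lra.
rewrite -Rmult_assoc Rinv_r ?Rmult_1_l; last lra.
apply: Rle_trans (ln_le_harm n) _; apply: Rle_trans (harm_le_sqfree n) _.
by apply: Rmult_le_compat_r (zeta2_le n); exact: sqfree_harm_ge0.
Qed.

(** The [n.+1] in [sqfree_harm_ge] absorbs the floor, as [n / d ^ 2] is at most the floor plus 1.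
    The bound covers [d ^ 2 > n] too, where its left side is negative. *)
Lemma sqfree_harm_div_ge n d : (0 < n)%N -> (0 < d)%N ->
  6 / PI ^ 2 * (ln (INR n) - 2 * ln (INR d)) <= sqfree_harm (n %/ d ^ 2).
Proof.
move=> n0 d0; apply: Rle_trans (sqfree_harm_ge _).
have n1 := INR_gt0 n0; have d1 := INR_gt0 d0; have z := zeta2_limit_gt.
apply: Rmult_le_compat_l; first by apply: Rlt_le; apply: Rdiv_lt_0_compat; lra.
have -> : 2 * ln (INR d) = ln (INR d * INR d) by rewrite ln_mult //; lra.
rewrite -ln_div //; last by nra.
apply: ln_le_mono; first by apply: Rdiv_lt_0_compat => //; nra.
apply: (Rmult_le_reg_r (INR d * INR d)); first by nra.
rewrite /Rdiv Rmult_assoc Rinv_l ?Rmult_1_r; last by nra.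
rewrite -!INR_muln; apply: INR_leq.
by rewrite mulnn ltnW // ltn_ceil // expn_gt0 d0.
Qed.

(** Since [ln x <= n * ln (1 + y) <= n * y], one comparison of rationals certifies a numerical bound
    on a logarithm. *)
Lemma ln_le_pow n x y : 0 < x -> 0 < 1 + y -> x <= (1 + y) ^ n ->
  ln x <= INR n * y.
Proof.
move=> x0 y0 /(ln_le_mono x0); rewrite ln_pow // => xl.
have := ln_le_sub1 y0; have := pos_INR n; nra.
Qed.

Lemma ln2_ge : 67 / 100 <= ln 2.
Proof.
have := @ln_le_pow 16 (/ 2) (- 67 / 1600).
rewrite ln_Rinv /=; lra.
Qed.

Lemma ln2_le : ln 2 <= 7 / 10.
Proof. by have := @ln_le_pow 64 2 (7 / 640); rewrite INR_IZR_INZ /=; lra. Qed.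

Lemma ln3_le : ln 3 <= 1106 / 1000.
Proof. by have := @ln_le_pow 128 3 (1106 / 128000); rewrite INR_IZR_INZ /=; lra. Qed.

(* [(ln n + 1) / n] is the integral of [ln x / x ^ 2] over [x >= n]. *)
Lemma ln_div_sqr_telescope n : (2 < n)%N ->
  / INR n.+1 ^ 2 * ln (INR n.+1)
    <= (ln (INR n) + 1) / INR n - (ln (INR n.+1) + 1) / INR n.+1.
Proof.
move=> n2.
have n3 : 3 <= INR n by rewrite (_ : 3 = INR 3); [exact: INR_leq|rewrite /=; ring].
(* The bound 4 / 3 makes [L * x - (x + 1)] nonnegative for [x >= 3]; hence the condition [2 < n]. *)
have L4 : 4 / 3 <= ln (INR n.+1).
  have : ln (2 * 2) <= ln (INR n.+1) by apply: ln_le_mono; rewrite ?S_INR; lra.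
  by rewrite ln_mult; have := ln2_ge; lra.
have := lnS_sub_le (ltnW (ltnW n2)); move: L4; rewrite S_INR.
move: (ln (INR n + 1)) (ln (INR n)) => L l; move: (INR n) n3 => x x3 L4 Ll.
apply: (Rle_trans _ ((L - / x + 1) / x - (L + 1) / (x + 1))); last first.
  suff : (L - / x + 1) / x <= (l + 1) / x by lra.
  apply: Rmult_le_compat_r; last lra.
  by apply/Rlt_le/Rinv_0_lt_compat; lra.
have -> : (L - / x + 1) / x - (L + 1) / (x + 1)
   = / (x + 1) ^ 2 * L + (L * x - (x + 1)) / (x ^ 2 * (x + 1) ^ 2).
  by field; lra.
have : 0 <= (L * x - (x + 1)) / (x ^ 2 * (x + 1) ^ 2).
  apply: Rmult_le_pos; first by nra.
  by apply/Rlt_le/Rinv_0_lt_compat/Rmult_lt_0_compat; apply: pow_lt; lra.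
by lra.
Qed.

(** The terms 2 and 3 are kept and the others telescope to at most [(ln 3 + 1) / 3]; with the
    rational bounds for [ln 2] and [ln 3] the total is about 0.9999. *)
Lemma sum_ln_div_sqr_le n :
  \sum_(2 <= d < n.+4) / INR d ^ 2 * ln (INR d) <= 1.
Proof.
have n1 := INR_ge1 (ltn0Sn n.+2); have l0 := ln_ge0 n1.
have : 0 <= (ln (INR n.+3) + 1) / INR n.+3.
  by apply/Rlt_le/Rdiv_lt_0_compat; lra.
suff : \sum_(2 <= d < n.+4) / INR d ^ 2 * ln (INR d)
    <= ln 2 / 4 + ln 3 / 9 + (ln 3 + 1) / 3 - (ln (INR n.+3) + 1) / INR n.+3.
  by have := ln2_le; have := ln3_le; lra.
elim: n {n1 l0} => [|n IH].
  rewrite 2?big_nat_recr // big_geq //=.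
  by rewrite -[1 + 1]/2 (_ : 2 + 1 = 3); [lra|ring].
have := @ln_div_sqr_telescope n.+3 isT; rewrite big_nat_recr //.
by move: (INR n.+4) (INR n.+3) IH => y x /=; lra.
Qed.

(* Isolating [d = 1] in [sqfree_le_harm] and bounding the other terms from below
   by [sqfree_harm_div_ge], the [ln n] of [harm n] cancels as [D] grows, since
   [zeta2 D] tends to [PI ^ 2 / 6]. *)
Lemma sqfree_harm_le n : (0 < n)%N ->
  sqfree_harm n <= 6 / PI ^ 2 * ln (INR n) + 2165 / 1000.
Proof.
move=> n0; have n1 := INR_ge1 n0; have l0 := ln_ge0 n1.
have z := zeta2_limit_gt; have pi0 := PI_RGT_0.
set a := 6 / PI ^ 2.
have aE : a * (PI ^ 2 / 6) = 1 by rewrite /a; field; lra.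
have a0 : 0 < a by apply: Rdiv_lt_0_compat; nra.
have a3 : a <= 2 / 3 by nra.
case: (leqP n 1) => [n_le1|n2].
  have -> : n = 1%N by apply/eqP; rewrite eqn_leq n_le1.
  by rewrite /sqfree_harm big_mkcond big_nat1 /= ln_1 Rinv_1; lra.
(* [harm n - ln n] is at most [1.5 - 0.67] and [2 * a] at most [4 / 3], together below 2.164. *)
apply: (Rle_trans _ (harm n - ln (INR n) + a * ln (INR n) + 2 * a)); last first.
  by have := harm_le_ln n2; have := ln2_ge; lra.
apply: le_epsilon => e e0.
have l1 : 0 < 1 + ln (INR n) by lra.
have [D0 hD0] := zeta2_approx (Rdiv_lt_0_compat _ _ e0 l1).
(* The shift by 3 gives the range [2 <= d < D0.+4] of [sum_ln_div_sqr_le]. *)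
pose D := D0.+3.
have hD : PI ^ 2 / 6 - e / (1 + ln (INR n)) <= zeta2 D.
  by apply: Rle_trans hD0 _; apply: zeta2_mono; rewrite /D; lia.
have inv1 : / INR 1 ^ 2 = 1 by rewrite /=; field.
pose U := \sum_(2 <= d < D.+1) / INR d ^ 2 * sqfree_harm (n %/ d ^ 2).
have H : sqfree_harm n + U <= harm n.
  apply: Rle_trans (sqfree_le_harm n D); rewrite [X in _ <= X]big_ltn //.
  by rewrite inv1 exp1n divn1 Rmult_1_l; exact: Rle_refl.
have : a * (ln (INR n) * (zeta2 D - 1) - 2) <= U.
  pose V := \sum_(2 <= d < D.+1) / INR d ^ 2.
  have zV : zeta2 D = 1 + V by rewrite /zeta2 big_ltn // inv1.
  pose B := \sum_(2 <= d < D.+1) / INR d ^ 2 * ln (INR d).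
  have B1 : B <= 1 by exact: sum_ln_div_sqr_le.
  apply: (Rle_trans _ (\sum_(2 <= d < D.+1)
     (a * ln (INR n) * / INR d ^ 2 + - 2 * a * (/ INR d ^ 2 * ln (INR d))))).
    apply: (Rle_trans _ (a * ln (INR n) * V + - 2 * a * B)); first by rewrite zV; nra.
    by rewrite big_split -!big_distrr; exact: Rle_refl.
  apply: ler_sum => d; rewrite mem_index_iota => /andP[d1 _] _.
  have d0 := ltnW d1.
  have := Rmult_le_compat_l _ _ _ (inv_sqr_ge0 d0) (sqfree_harm_div_ge n0 d0).
  by rewrite -/a; lra.
(* As [a * (PI ^ 2 / 6) = 1], replacing [zeta2 D] by its limit costs [a < 1] times this quantity,
   which the choice of [D] keeps under [e]. *)
suff : ln (INR n) * (PI ^ 2 / 6 - zeta2 D) <= e by nra.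
have : e / (1 + ln (INR n)) * (1 + ln (INR n)) = e by field; lra.
have : 0 < e / (1 + ln (INR n)) by exact: Rdiv_lt_0_compat.
by nra.
Qed.

(** * Roots of x (x + M) modulo d *)


Definition rho (M d : nat) : nat := (\sum_(0 <= x < d) (d %| x * (x + M)))%N.

Lemma coprime_no_prime a b : (0 < a)%N ->
  (forall p, prime p -> p %| a -> p %| b -> False)%N -> coprime a b.
Proof.
move=> a0 H; rewrite /coprime eqn_leq gcdn_gt0 a0 andbT leqNgt; apply/negP => g1.
have := pdiv_dvd (gcdn a b); rewrite dvdn_gcd => /andP[pa pb].
exact: H (pdiv_prime g1) pa pb.
Qed.

Lemma sqfree_primeP l : (0 < l)%N ->
  (forall p, prime p -> ~~ (p ^ 2 %| l)%N) -> sqfree l.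
Proof.
move=> l0 H; apply/sqfreeP; split=> // h hl.
have h0 : (0 < h)%N by case: h hl => //; rewrite dvd0n; lia.
apply/eqP; rewrite eqn_leq h0 andbT leqNgt; apply/negP => h1.
have /negP := H _ (pdiv_prime h1); apply.
by apply: dvdn_trans hl; rewrite dvdn_exp2r // pdiv_dvd.
Qed.

(** * Radicals of integers *)

Definition rad (n : nat) : nat := (\prod_(p <- primes n) p)%N.

Lemma prime_dvd_prod p s : prime p -> all prime s ->
  (p %| \prod_(q <- s) q)%N = (p \in s).
Proof.
move=> pp; elim: s => [|q s IH] /=; first by rewrite big_nil Euclid_dvd1.
by case/andP => qp sp; rewrite big_cons Euclid_dvdM // inE IH // dvdn_prime2.
Qed.

Lemma all_prime_primes n : all prime (primes n).
Proof. by apply/allP => p; rewrite mem_primes => /andP[]. Qed.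

Lemma prime_dvd_rad p n : prime p -> (0 < n)%N -> (p %| rad n)%N = (p %| n)%N.
Proof.
by move=> pp n0; rewrite prime_dvd_prod ?all_prime_primes // mem_primes pp n0.
Qed.

Lemma rad_gt0 n : (0 < rad n)%N.
Proof.
rewrite /rad big_seq prodn_cond_gt0 // => p.
by rewrite mem_primes => /andP[/prime_gt0].
Qed.

Lemma prod_primes_dvdn s n : uniq s -> all prime s ->
  (forall p, p \in s -> p %| n)%N -> (\prod_(p <- s) p %| n)%N.
Proof.
elim: s => [|p s IH] /=; first by rewrite big_nil dvd1n.
move=> /andP[ps us] /andP[pp sp] H; rewrite big_cons Gauss_dvd.
  by rewrite H ?mem_head // IH // => q qs; rewrite H // inE qs orbT.
by rewrite prime_coprime // prime_dvd_prod.
Qed.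

Lemma rad_dvdn n : (rad n %| n)%N.
Proof.
apply: prod_primes_dvdn; [exact: primes_uniq|exact: all_prime_primes|].
by move=> p; rewrite mem_primes => /and3P[].
Qed.

Lemma rad_sqfree n : sqfree (rad n).
Proof.
apply: sqfree_primeP; first exact: rad_gt0.
move=> p pp; rewrite /rad.
elim: (primes n) (primes_uniq n) (all_prime_primes n) => [|q s IH] /=.
  by rewrite big_nil dvdn1 -(exp1n 2) eqn_exp2r // => _ _; apply/negP => /eqP p1; rewrite p1 in pp.
move=> /andP[qs us] /andP[qp sp]; rewrite big_cons.
case: (eqVneq p q) => [->|npq].
  by rewrite -mulnn dvdn_pmul2l ?prime_gt0 // prime_dvd_prod.
rewrite Gauss_dvdr; first exact: IH.
by rewrite coprimeXl // prime_coprime // dvdn_prime2.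
Qed.

Lemma sum_nat_of_bool (r : seq nat) (P Q : pred nat) :
  (\sum_(i <- r | P i) Q i)%N = size [seq i <- r | P i && Q i].
Proof.
rewrite -sum1_size big_filter [RHS]big_mkcondr; apply: eq_bigr => i _.
by case: (Q i).
Qed.

Section PrimitiveRoots.
Variables (q n : nat).
Hypothesis (n0 : (0 < n)%N).
Hypothesis (Hpp : forall p, prime p -> (p %| q)%N -> ~~ (p ^ 2 %| n)%N).

Let sol y := (n %| y * (y + q))%N.
Let e y := gcdn y n.
Let f y := (n %/ e y)%N.

Let e_gt0 y : (0 < e y)%N. Proof. by rewrite gcdn_gt0 n0 orbT. Qed.
Let ef y : (e y * f y = n)%N. Proof. by rewrite mulnC divnK // dvdn_gcdr. Qed.

(** Write [y = y' * e y]. Cancelling [e y] in [e y * f y %| y * (y + q)] leaves [f y] dividing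
    [y' * (y + q)], and [f y] is coprime to [y']. *)
Let f_dvd y : sol y -> (f y %| y + q)%N.
Proof.
rewrite /sol => Sy; have [y' yE] := dvdnP (dvdn_gcdl y n).
have c : coprime (f y) y'.
  rewrite /coprime -(eqn_pmul2r (e_gt0 y)) mul1n muln_gcdl.
  by rewrite [(f y * e y)%N]mulnC ef -yE gcdnC.
rewrite -(Gauss_dvdr _ c) -(dvdn_pmul2l (e_gt0 y)) ef.
by rewrite mulnA [(e y * y')%N]mulnC -yE.
Qed.

(** Thus [e y] and [f y] are coprime: a common prime divides [y] and [y + q], hence [q], while its
    square divides [e y * f y = n], against [Hpp]. *)
Let prime_ef p y : sol y -> prime p -> (p %| e y)%N -> (p %| f y)%N -> False.
Proof.
move=> Sy pp pe pf.
have pq : (p %| q)%N.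
  have /dvdn_addr <- : (p %| y)%N by apply: dvdn_trans pe (dvdn_gcdl _ _).
  by apply: dvdn_trans pf (f_dvd Sy).
by have /negP := Hpp pp pq; apply; rewrite -mulnn -(ef y) dvdn_mul.
Qed.

(** Having the same primes as [e y2], the number [e y1] is coprime to [f y2], and it divides
    [n = e y2 * f y2]. *)
Let e_dvd y1 y2 : sol y2 -> rad (e y1) = rad (e y2) -> (e y1 %| e y2)%N.
Proof.
move=> S2 E.
have c : coprime (e y1) (f y2).
  apply: coprime_no_prime => // p pp p1 p2; apply: (prime_ef S2 pp _ p2).
  by rewrite -(prime_dvd_rad pp) // -E prime_dvd_rad.
by rewrite -(Gauss_dvdl _ c) ef dvdn_gcdr.
Qed.

(** Divisibility both ways gives [e y1 = e y2] and [f y1 = f y2]. These coprime numbers both divide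
    [y2 - y1], so [n] does, and [y2 - y1 < n]. *)
Let rad_inj y1 y2 : sol y1 -> sol y2 -> (y1 <= y2)%N -> (y2 < n)%N ->
  rad (e y1) = rad (e y2) -> y1 = y2.
Proof.
move=> S1 S2 y12 y2n E.
have ee : e y1 = e y2.
  by apply/eqP; rewrite eqn_dvd (e_dvd S2 E) (e_dvd S1 (esym E)).
have ff : f y1 = f y2 by rewrite /f ee.
have : (n %| y2 - y1)%N.
  rewrite -(ef y1) Gauss_dvd.
    rewrite dvdn_sub ?dvdn_gcdl //=; last by rewrite ee dvdn_gcdl.
    by rewrite -(subnDr q) dvdn_sub // ?f_dvd // ff f_dvd.
  by apply: coprime_no_prime => // p pp; exact: prime_ef.
move=> nd; apply/eqP; rewrite eqn_leq y12 -subn_eq0 /=.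
by apply: contraLR nd; rewrite -lt0n => d0; rewrite gtnNdvd //; lia.
Qed.

(* A root [y] is determined by the set of primes dividing [gcdn y n], which is
   recorded by the squarefree number [rad (gcdn y n)]. *)
Lemma rho_primitive_le :
  (rho q n <= \sum_(1 <= l < n.+1 | sqfree l && (l %| n)) coprime (n %/ l) q)%N.
Proof.
rewrite /rho !sum_nat_of_bool -(size_map (fun y => rad (e y))).
apply: uniq_leq_size.
  rewrite map_inj_in_uniq ?filter_uniq ?iota_uniq // => y1 y2.
  rewrite !mem_filter !mem_index_iota => /andP[S1 /andP[_ y1n]] /andP[S2 /andP[_ y2n]] E.
  case: (leqP y1 y2) => [|/ltnW] le12; first exact: rad_inj.
  by apply/esym/rad_inj.
move=> l /mapP[y]; rewrite mem_filter mem_index_iota => /andP[Sy _] ->.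
have rn : (rad (e y) %| n)%N by apply: dvdn_trans (rad_dvdn _) (dvdn_gcdr _ _).
rewrite mem_filter mem_index_iota rad_sqfree rad_gt0 rn ltnS (dvdn_leq n0 rn) /= andbT.
(* A prime [p] dividing [n / l] and [q] divides [n], thus [y] and [l], so [p ^ 2 %| n], against
   [Hpp]. *)
apply: coprime_no_prime => [|p pp p1 p2].
  by rewrite divn_gt0 ?rad_gt0 // dvdn_leq.
have pn : (p %| n)%N by apply: dvdn_trans p1 (dvdn_div rn).
have py : (p %| y)%N.
  have : (p %| y * (y + q))%N by exact: dvdn_trans pn Sy.
  by rewrite Euclid_dvdM // => /orP[//|]; rewrite dvdn_addl.
have pr : (p %| rad (e y))%N by rewrite prime_dvd_rad // dvdn_gcd py.
have /negP := Hpp pp p2; apply.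
by rewrite -mulnn -(divnK rn) dvdn_mul.
Qed.

End PrimitiveRoots.

(** Cancelling the square of [h = gcdn x g] leaves [g' = g / h] dividing [x' * (x' + g' * q)] with
    [x' = x / h] coprime to [g']; hence [g' %| x'] and [g' = 1]. *)
Lemma dvdn_root_scale g q n x : (0 < g)%N ->
  (g ^ 2 * n %| x * (x + g * q))%N -> (g %| x)%N.
Proof.
move=> g0 H; pose h := gcdn x g.
have h0 : (0 < h)%N by rewrite gcdn_gt0 g0 orbT.
have [x' xE] := dvdnP (dvdn_gcdl x g); have [g' gE] := dvdnP (dvdn_gcdr x g).
rewrite -/h in xE gE.
have c : coprime g' x'.
  by rewrite /coprime -(eqn_pmul2r h0) mul1n muln_gcdl -gE -xE gcdnC.
have : (g' %| x' * (x' + g' * q))%N.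
  rewrite -(@dvdn_pmul2r (h ^ 2)) ?expn_gt0 ?h0 //.
  have -> : (x' * (x' + g' * q) * h ^ 2 = x * (x + g * q))%N by rewrite xE gE; nia.
  apply: dvdn_trans H; rewrite gE expnMn -mulnA.
  by apply: dvdn_mul; [rewrite -mulnn dvdn_mulr|rewrite dvdn_mulr].
rewrite Gauss_dvdr // dvdn_addl ?dvdn_mulr // => g'x'.
have g'1 : g' = 1%N by apply/eqP; rewrite -dvdn1 -(eqP c) dvdn_gcd dvdnn.
by rewrite gE g'1 mul1n dvdn_gcdl.
Qed.

Lemma rho_periodic M d k :
  (d %| (k + d) * (k + d + M))%N = (d %| k * (k + M))%N.
Proof.
have -> : ((k + d) * (k + d + M) = (k + (k + d + M)) * d + k * (k + M))%N by nia.
by rewrite dvdn_addr // dvdn_mull.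
Qed.

(** Every root modulo [g ^ 2 * n] is [g * y] with [y] a root modulo [n], and [y] then runs over [g]
    full periods of length [n]. *)
Lemma rho_scale g q n : (0 < g)%N -> (rho (g * q) (g ^ 2 * n) = g * rho q n)%N.
Proof.
move=> g0; rewrite /rho.
have per m M k : nat_of_bool (m %| (k + m) * (k + m + M))%N = (m %| k * (k + M))%N.
  by rewrite rho_periodic.
rewrite -[LHS]mul1n -(sum_periodic_mul1 _ (per _ _)) mul1n.
rewrite -(sum_periodic_mul1 _ (per _ _)).
rewrite (_ : (g * n = (g ^ 2 * n) %/ g)%N); last by rewrite -mulnn -mulnA mulKn.
rewrite -[LHS](@big_rmcond_in _ _ addn _ _ (fun x => g %| x)%N) => [|x _ gx].
  rewrite big_multiples //; apply: eq_bigr => y _.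
  have -> : (g * y * (g * y + g * q) = g ^ 2 * (y * (y + q)))%N by nia.
  by rewrite dvdn_pmul2l // expn_gt0 g0.
by apply/eqP; rewrite eqb0; apply: contra gx => /(dvdn_root_scale g0).
Qed.

(** Only the largest admissible [g] is used: [rho_primitive_le] applies to it, since an offending
    prime [p] would make [g * p] admissible. Summing over all [g] removes the maximality condition,
    which allows an exchange with a sum over [d]. *)
Lemma rho_le M d : (0 < M)%N -> (0 < d)%N ->
  (rho M d <= \sum_(1 <= g < M.+1 | (g %| M) && (g ^ 2 %| d)) g *
     \sum_(1 <= l < (d %/ g ^ 2).+1 | sqfree l && (l %| d %/ g ^ 2))
       coprime (d %/ g ^ 2 %/ l) (M %/ g))%N.
Proof.
move=> M0 d0.
have exg : exists g, ((g %| M) && (g ^ 2 %| d))%N by exists 1%N; rewrite !dvd1n.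
have ubg g : ((g %| M) && (g ^ 2 %| d) -> g <= M)%N by move=> /andP[/dvdn_leq->].
case: (ex_maxnP exg ubg) => g gP gmax; have [gM gd] := andP gP.
have g0 : (0 < g)%N := dvdn_gt0 M0 gM.
rewrite (big_rem g) /=; last by rewrite mem_index_iota g0 ltnS dvdn_leq.
rewrite gP; apply: leq_trans (leq_addr _ _).
rewrite -{1}(divnK gM) -{1}(divnK gd) [(M %/ g * g)%N]mulnC [(d %/ _ * _)%N]mulnC rho_scale //.
rewrite leq_pmul2l //; apply: (@rho_primitive_le (M %/ g) (d %/ g ^ 2)) => [|p pp pq].
  by rewrite divn_gt0; [exact: dvdn_leq|rewrite expn_gt0 g0].
apply/negP => pn; have := gmax (g * p)%N.
have -> : (g * p %| M)%N by rewrite -(divnK gM) mulnC dvdn_mul.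
have -> : ((g * p) ^ 2 %| d)%N by rewrite -(divnK gd) expnMn mulnC dvdn_mul.
move=> /(_ isT); rewrite leqNgt => /negP; apply.
by rewrite -{1}[g]muln1 ltn_pmul2l // prime_gt1.
Qed.

Definition coprime_count (m q : nat) : nat := (\sum_(1 <= k < m.+1) coprime k q)%N.

(** Substituting [d = g ^ 2 * k], then [k = l * m], leaves for each [g] and [l] a count of the [m]
    coprime to [M / g]. *)
Lemma sum_rho_le M n : (0 < M)%N ->
  (\sum_(1 <= d < n.+1) rho M d <= \sum_(1 <= g < M.+1 | g %| M)
     g * \sum_(1 <= l < (n %/ g ^ 2).+1 | sqfree l)
        coprime_count (n %/ g ^ 2 %/ l) (M %/ g))%N.
Proof.
move=> M0.
pose T g m := (\sum_(1 <= l < m.+1 | sqfree l && (l %| m)) coprime (m %/ l) (M %/ g))%N.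
apply: (@leq_trans (\sum_(1 <= d < n.+1) \sum_(1 <= g < M.+1 | (g %| M) && (g ^ 2 %| d))
    g * T g (d %/ g ^ 2)%N)%N).
  rewrite big_seq [X in (_ <= X)%N]big_seq; apply: leq_sum => d; rewrite mem_index_iota => /andP[d0 _].
  exact: rho_le.
rewrite (exchange_big_dep (fun g => g %| M)%N) /=; last by move=> d g _ /andP[].
rewrite big_seq_cond [X in (_ <= X)%N]big_seq_cond; apply: leq_sum => g /andP[]; rewrite mem_index_iota => /andP[g0 _] gM.
rewrite (eq_bigl (fun d => g ^ 2 %| d)%N) => [|d]; last by rewrite gM.
rewrite big_multiples ?expn_gt0 ?g0 // -big_distrr leq_mul2l /=.
apply/orP; right; set N := (n %/ g ^ 2)%N.
(* The range of [l] is enlarged from [k] to [N], to be independent of [k] before the exchange. *)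
apply: (@leq_trans (\sum_(1 <= k < N.+1) \sum_(1 <= l < N.+1 | sqfree l && (l %| k))
    coprime (k %/ l) (M %/ g))%N).
  rewrite big_seq [X in (_ <= X)%N]big_seq; apply: leq_sum => k; rewrite mem_index_iota => /andP[k0 kN].
  rewrite mulKn ?expn_gt0 ?g0 // /T.
  by rewrite [X in (_ <= X)%N](@big_cat_nat _ _ _ k.+1) ?leq_addr //.
rewrite (exchange_big_dep sqfree) /=; last by move=> k l _ /andP[].
rewrite big_seq_cond [X in (_ <= X)%N]big_seq_cond; apply: leq_sum => l /andP[].
rewrite mem_index_iota => /andP[l0 _] sl.
rewrite (eq_bigl (fun k => l %| k)%N) => [|k]; last by rewrite sl.
rewrite big_multiples // /coprime_count.
by apply: leq_sum => k _; rewrite mulKn.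
Qed.

(** * Integers coprime to M / g *)


Definition ndiv (n : nat) : nat := (\sum_(1 <= d < n.+1 | d %| n) 1)%N.

Lemma ndivE n : ndiv n = size [seq d <- index_iota 1 n.+1 | d %| n]%N.
Proof. by rewrite -sum1_size big_filter. Qed.

(** Each divisor [d] of [n] yields the divisors [d] and [p * d] of the product; the two families are
    disjoint as [p] does not divide [n]. *)
Lemma ndiv_mul_prime_pow p v n : prime p -> (0 < v)%N -> (0 < n)%N -> coprime p n ->
  (2 * ndiv n <= ndiv (n * p ^ v))%N.
Proof.
move=> pp v0 n0 cpn; rewrite mul2n -addnn !ndivE; set s := [seq _ <- _ | _].
have p0 := prime_gt0 pp.
rewrite -{2}(size_map (muln p)) -size_cat; apply: uniq_leq_size.
  rewrite cat_uniq filter_uniq ?iota_uniq // map_inj_uniq ?filter_uniq ?iota_uniq //=; last first.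
    by move=> x y /eqP; rewrite eqn_pmul2l // => /eqP.
  rewrite andbT; apply/hasPn => _ /mapP[d _ ->]; apply/negP.
  rewrite /s mem_filter => /andP[/(dvdn_trans (dvdn_mulr d (dvdnn p))) pn _].
  by move: cpn; rewrite prime_coprime // pn.
move=> d; rewrite mem_cat [in X in _ -> X]mem_filter mem_index_iota ltnS.
have nv0 : (0 < n * p ^ v)%N by rewrite muln_gt0 n0 expn_gt0 p0.
move=> H; have dv : (d %| n * p ^ v)%N.
  case/orP: H => [|/mapP[e]]; rewrite /s mem_filter => /andP[dn _].
    exact: dvdn_mulr.
  by move=> ->; rewrite mulnC dvdn_mul //; case: v v0 {nv0} => // v _; rewrite expnS dvdn_mulr.
by rewrite dv (dvdn_gt0 nv0 dv) dvdn_leq.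
Qed.

Lemma coprime_count_prime p v q N : prime p -> (0 < v)%N -> coprime p q ->
  (coprime_count N (q * p ^ v) + coprime_count (N %/ p) q = coprime_count N q)%N.
Proof.
move=> pp v0 cpq; have p0 := prime_gt0 pp; rewrite /coprime_count.
have -> : (\sum_(1 <= k < (N %/ p).+1) coprime k q
    = \sum_(1 <= k < N.+1 | p %| k) coprime k q)%N.
  by rewrite big_multiples //; apply: eq_bigr => k _; rewrite coprimeMl cpq.
rewrite [X in (_ + X)%N]big_mkcond -big_split; apply: eq_bigr => k _ /=.
rewrite coprimeMr coprime_pexpr // [coprime k p]coprime_sym (prime_coprime _ pp).
by case: (p %| k)%N; rewrite ?andbF ?andbT ?addn0.
Qed.

Definition tratio (q : nat) : R := INR (totient q) / INR q.

Lemma tratio_mul_prime_pow p v q : prime p -> (0 < v)%N -> (0 < q)%N -> coprime p q ->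
  tratio (q * p ^ v) = tratio q * (1 - / INR p).
Proof.
move=> pp v0 q0 cpq; rewrite /tratio totient_coprime; last first.
  by rewrite coprime_sym coprimeXl.
rewrite totient_pfactor // !INR_muln; case: v v0 => // v _; rewrite expnS INR_muln /=.
have p0 := prime_gt0 pp; have p1 := INR_gt0 p0; have q1 := INR_gt0 q0.
have pv : 0 < INR (p ^ v)%N by apply: INR_gt0; rewrite expn_gt0 p0.
have -> : INR p.-1 = INR p - 1 by rewrite -{2}(prednK p0) S_INR; ring.
by field; lra.
Qed.

Lemma coprime_count_pow2 i N : (0 < i)%N -> coprime_count N (2 ^ i) = uphalf N.
Proof.
move=> i0; rewrite /coprime_count; elim: N => [|N IH]; first by rewrite big_geq.
rewrite big_nat_recr //= IH coprime_pexpr // coprimen2 /=.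
by rewrite uphalf_half /=; case: (odd N); rewrite /= ?addn0 ?addn1 ?add1n ?add0n.
Qed.

Lemma div_floor_bounds m r : (0 < r)%N ->
  INR (m %/ r)%N <= INR m / INR r <= INR (m %/ r)%N + 1.
Proof.
move=> r0; have r1 := INR_gt0 r0; split; first exact: INR_divn.
apply: (Rmult_le_reg_r (INR r)) => //; rewrite /Rdiv Rmult_assoc Rinv_l; last lra.
by rewrite Rmult_1_r -S_INR -INR_muln; apply/INR_leq/ltnW/ltn_ceil.
Qed.

(* Adjoining an odd prime to the modulus replaces a floor error lying in an
   interval by the difference of two such errors, which doubles the length of
   the interval and makes it symmetric. For a power of two the error lies in
   [[- 1 / 2, 1 / 2]]. *)
Lemma coprime_count_bounds i w : odd w -> exists a b,
  [/\ a + b <= INR (ndiv w), b <= INR (ndiv w) / 2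
    & forall m r, (0 < r)%N ->
      tratio (2 ^ i * w) * (INR m / INR r) - a
        <= INR (coprime_count (m %/ r) (2 ^ i * w))
        <= tratio (2 ^ i * w) * (INR m / INR r) + b].
Proof.
elim/ltn_ind: w => w IH ow; case: (leqP w 1) => [w1|w1].
  have -> : w = 1%N by case: w ow w1 {IH} => [|[|]].
  have -> : ndiv 1 = 1%N by rewrite /ndiv big_mkcond big_nat1.
  rewrite muln1; case: (posnP i) => [->|i0].
    exists 1, 0; rewrite expn0; split; [rewrite /=; lra|rewrite /=; lra|] => m r r0.
    have -> : tratio 1 = 1 by rewrite /tratio /=; field.
    have -> : coprime_count (m %/ r) 1 = (m %/ r)%N.
      rewrite /coprime_count; under eq_bigr do rewrite coprimen1.
      by rewrite sum_nat_const_nat subn1 muln1.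
    by have := div_floor_bounds m r0; lra.
  exists (/ 2), (/ 2); split; [rewrite /=; lra|rewrite /=; lra|] => m r r0.
  have -> : tratio (2 ^ i) = / 2.
    rewrite -[(2 ^ i)%N]mul1n tratio_mul_prime_pow ?coprimen1 //.
    by rewrite /tratio /=; field.
  rewrite coprime_count_pow2 //; have := div_floor_bounds m r0.
  move: (m %/ r)%N => N NB.
  have : INR N = INR (odd N) + 2 * INR N./2.
    by rewrite -{1}(odd_double_half N) -mul2n INR_addn INR_muln.
  by rewrite uphalf_half INR_addn; case: (odd N) => /=; lra.
have pp := pdiv_prime w1; set p := pdiv w in pp.
have p0 := prime_gt0 pp; have p1 := INR_gt0 p0.
have [w' cpw wE] := pfactor_coprime pp (ltnW w1); set v := logn p w in wE.
have v0 : (0 < v)%N by rewrite logn_gt0 mem_primes pp (ltnW w1) pdiv_dvd.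
have w'0 : (0 < w')%N by move: w1; rewrite wE; case: w' {cpw wE}.
have [ow' op] : odd w' /\ odd p.
  by move: ow; rewrite wE oddM oddX eqn0Ngt v0 /= => /andP.
have w'w : (w' < w)%N.
  rewrite wE -{1}[w']muln1 ltn_pmul2l //.
  by rewrite -{1}(expn0 p) ltn_exp2l // prime_gt1.
have [a [b [ab bn H]]] := IH _ w'w ow'.
have cq : coprime p (2 ^ i * w') by rewrite coprimeMr cpw andbT coprimeXr // coprimen2.
have q0 : (0 < 2 ^ i * w')%N by rewrite muln_gt0 expn_gt0.
have nd : 2 * INR (ndiv w') <= INR (ndiv w).
  rewrite (_ : 2 = INR 2) // -INR_muln; apply: INR_leq.
  by rewrite wE; exact: ndiv_mul_prime_pow.
(* Since [ndiv] at least doubles, both required inequalities follow from [a + b <= ndiv w']. *)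
exists (a + b), (a + b); split; [lra|lra|] => m r r0.
rewrite {}wE mulnA tratio_mul_prime_pow //.
have H1 := H m r r0; have rp0 : (0 < r * p)%N by rewrite muln_gt0 r0.
have H2 := H m (r * p)%N rp0.
have := coprime_count_prime (m %/ r) pp v0 cq; rewrite -divnMA => /(congr1 INR).
rewrite INR_addn => E.
have r1 := INR_gt0 r0.
have E2 : tratio (2 ^ i * w') * (INR m / INR (r * p)%N)
    = tratio (2 ^ i * w') * (INR m / INR r) * / INR p.
  by rewrite INR_muln; field; lra.
by rewrite E2 in H2; lra.
Qed.

Lemma coprime_count_le i w m r : odd w -> (0 < r)%N ->
  INR (coprime_count (m %/ r) (2 ^ i * w))
    <= tratio (2 ^ i * w) * (INR m / INR r) + INR (ndiv w) / 2.
Proof.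
by move=> ow r0; have [a [b [_ bn /(_ m r r0)]]] := coprime_count_bounds i ow; lra.
Qed.

Lemma divn_divKn M d : (0 < M)%N -> (d %| M)%N -> (M %/ (M %/ d) = d)%N.
Proof.
move=> M0 dM; rewrite -{1}(divnK dM) mulKn // divn_gt0 ?(dvdn_gt0 M0 dM) //.
exact: dvdn_leq.
Qed.

Lemma dvdn_divn M d : (d %| M)%N -> (M %/ d %| M)%N.
Proof. by move=> dM; rewrite -{2}(divnK dM) dvdn_mulr. Qed.

Lemma sum_tratio M : (0 < M)%N ->
  \sum_(1 <= g < M.+1 | (g %| M)%N) / INR g * tratio (M %/ g) = 1.
Proof.
move=> M0; have M1 := INR_gt0 M0.
transitivity (/ INR M * INR (\sum_(1 <= g < M.+1 | g %| M) totient (M %/ g))%N).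
  rewrite INR_sum big_distrr /= big_seq_cond [RHS]big_seq_cond.
  apply: eq_bigr => g; rewrite mem_index_iota => /andP[/andP[g0 _] gM].
  have g1 := INR_gt0 g0; rewrite /tratio INR_dvdn //.
  by field; lra.
have -> : (\sum_(1 <= g < M.+1 | g %| M) totient (M %/ g) = M)%N; last by field; lra.
rewrite -[RHS]sum_totient_dvd -(big_mkord (fun d => d %| M)%N totient).
(* [sum_totient_dvd] also ranges over the index 0, which does not divide [M]. *)
rewrite [RHS]big_ltn_cond // [in RHS](negbTE (_ : ~~ (0 %| M)%N)); last first.
  by rewrite dvd0n -lt0n.
rewrite -big_filter -[RHS]big_filter -(big_map (divn M) xpredT totient).
have dv g : (g %| M)%N -> (0 < g <= M)%N by move=> gM; rewrite (dvdn_gt0 M0 gM) dvdn_leq.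
apply: perm_big; apply: uniq_perm; rewrite ?filter_uniq ?iota_uniq //.
  rewrite map_inj_in_uniq ?filter_uniq ?iota_uniq // => x y.
  rewrite !mem_filter => /andP[xM _] /andP[yM _] E.
  by rewrite -(divn_divKn M0 xM) E divn_divKn.
move=> g; rewrite mem_filter mem_index_iota ltnS; apply/mapP/andP.
  move=> [h]; rewrite mem_filter => /andP[hM _ ->].
  by rewrite dvdn_divn //; split=> //; apply/dv/dvdn_divn.
move=> [gM gI]; exists (M %/ g)%N; last by rewrite divn_divKn.
by rewrite mem_filter mem_index_iota ltnS dvdn_divn // dv // dvdn_divn.
Qed.

Lemma dvdn_pow2_mul a Om g : odd Om -> (g %| 2 ^ a * Om)%N ->
  exists j g', [/\ (j <= a)%N, (g' %| Om)%N & g = (2 ^ j * g')%N].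
Proof.
move=> oOm gM; have Om0 : (0 < Om)%N by case: Om oOm {gM}.
have h0 : (0 < gcdn g Om)%N by rewrite gcdn_gt0 Om0 orbT.
have : (g %/ gcdn g Om %| 2 ^ a)%N.
  rewrite -(@Gauss_dvdl _ _ (Om %/ gcdn g Om)).
    rewrite -(dvdn_pmul2r h0) divnK ?dvdn_gcdl // -mulnA divnK ?dvdn_gcdr //.
  rewrite /coprime -(eqn_pmul2r h0) mul1n muln_gcdl.
  by rewrite !divnK ?dvdn_gcdl ?dvdn_gcdr.
case/(dvdn_pfactor _ _ (isT : prime 2)) => j ja gE.
exists j, (gcdn g Om); split=> //; first exact: dvdn_gcdr.
by rewrite -gE divnK // dvdn_gcdl.
Qed.

Lemma gcdn_pow2_mul j g Om : odd Om -> (g %| Om)%N -> gcdn (2 ^ j * g) Om = g.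
Proof.
move=> oOm gOm; rewrite -{1}(divnK gOm) -muln_gcdl.
rewrite (_ : gcdn _ _ = 1%N) ?mul1n //; apply/eqP.
rewrite -/(coprime _ _) coprimeXl // coprime2n.
by apply: contraTT oOm => e; rewrite -(divnK gOm) oddM negb_and e.
Qed.

Lemma pow2_mul_div a Om j g : (j <= a)%N -> (g %| Om)%N -> (0 < g)%N ->
  (2 ^ a * Om %/ (2 ^ j * g) = 2 ^ (a - j) * (Om %/ g))%N.
Proof.
move=> ja gOm g0; rewrite -{1}(subnK ja) expnD mulnAC divnMA -mulnA.
rewrite -{1}(divnK gOm) [(_ * (2 ^ j))%N]mulnC.
by rewrite (mulnC (2 ^ j)%N) !mulnA mulnK ?expn_gt0 // mulnK.
Qed.

(** The part of the constant in [sum_rho_bound] that comes from the errors in counting coprime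
    integers. *)
Definition weighted_ndiv (Om : nat) : R :=
  \sum_(1 <= g < Om.+1 | (g %| Om)%N) / INR g * INR (ndiv (Om %/ g)).

Lemma geometric_half_le a : \sum_(0 <= j < a) / 2 ^ j <= 2.
Proof.
suff -> : \sum_(0 <= j < a) / 2 ^ j = 2 - 2 * / 2 ^ a.
  by have := Rinv_0_lt_compat (2 ^ a) (pow_lt 2 a ltac:(lra)); lra.
elim: a => [|a IH]; first by rewrite big_geq //=; field.
by rewrite big_nat_recr //= IH; field; apply: pow_nonzero; lra.
Qed.

(** With [g = 2 ^ j * g'], the sum of [1 / 2 ^ j] is at most 2 and cancels the [1 / 2] of
    [coprime_count_le], so the bound is free of [a]. *)
Lemma sum_odd_ndiv_le a Om : odd Om ->
  \sum_(1 <= g < (2 ^ a * Om).+1 | (g %| 2 ^ a * Om)%N)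
     / INR g * (INR (ndiv (Om %/ gcdn g Om)) / 2) <= weighted_ndiv Om.
Proof.
move=> oOm; have Om0 : (0 < Om)%N by case: Om oOm.
have M0 : (0 < 2 ^ a * Om)%N by rewrite muln_gt0 expn_gt0.
pose D := [seq g <- index_iota 1 Om.+1 | g %| Om]%N.
have DP g : (g \in D) = (g %| Om)%N.
  rewrite mem_filter mem_index_iota ltnS andb_idr // => gOm.
  by rewrite (dvdn_gt0 Om0 gOm) dvdn_leq.
pose F g := / INR g * (INR (ndiv (Om %/ gcdn g Om)) / 2).
rewrite -big_filter.
apply: (Rle_trans _ (\sum_(g <- [seq (2 ^ j * g)%N | j <- index_iota 0 a.+1, g <- D]) F g)).
  apply: ler_sum_sub; first exact/filter_uniq/iota_uniq.
    move=> g; rewrite mem_filter => /andP[/(dvdn_pow2_mul oOm)[j [g' [ja gO ->]]] _].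
    by apply: allpairs_f; [rewrite mem_index_iota ltnS|rewrite DP].
  move=> g _; apply: Rmult_le_pos.
    by case: g => [|g]; [rewrite Rinv_0; lra|exact: inv_INR_ge0].
  by have := pos_INR (ndiv (Om %/ gcdn g Om)); lra.
rewrite big_allpairs_dep.
apply: (Rle_trans _ (\sum_(0 <= j < a.+1) / 2 ^ j * (weighted_ndiv Om / 2))).
  apply: ler_sum => j _ _; apply: Req_le.
  have -> : weighted_ndiv Om = \sum_(g <- D) / INR g * INR (ndiv (Om %/ g)) by rewrite big_filter.
  rewrite /Rdiv big_distrl big_distrr /=.
  rewrite big_seq [RHS]big_seq; apply: eq_bigr => g; rewrite DP => gOm.
  have g1 := INR_gt0 (dvdn_gt0 Om0 gOm).
  rewrite /F gcdn_pow2_mul // INR_muln INR_expn2 /=.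
  by field; split; [lra|apply: pow_nonzero; lra].
have Z0 : 0 <= weighted_ndiv Om.
  apply: sum_ge0 => g; rewrite mem_index_iota => /andP[g0 _] _.
  by apply: Rmult_le_pos; [exact: inv_INR_ge0|exact: pos_INR].
rewrite -big_distrl /=; have := geometric_half_le a.+1; nra.
Qed.

(** The main terms sum to [n * sqfree_harm n] by [sum_tratio]. The error [E g], of weight [g],
    occurs for at most [n / g ^ 2] values of [l], hence the summand [n * E g / g]. *)
Lemma sum_rho_bound a Om n : odd Om -> (0 < n)%N ->
  INR (\sum_(1 <= d < n.+1) rho (2 ^ a * Om) d)%N
    <= INR n * (6 / PI ^ 2 * ln (INR n) + (2165 / 1000 + weighted_ndiv Om)).
Proof.
move=> oOm n0; have Om0 : (0 < Om)%N by case: Om oOm.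
set M := (2 ^ a * Om)%N; have M0 : (0 < M)%N by rewrite muln_gt0 expn_gt0.
have n1 := INR_gt0 n0; set al := 6 / PI ^ 2.
apply: Rle_trans (INR_leq (sum_rho_le n M0)) _; rewrite INR_sum.
pose E g := INR (ndiv (Om %/ gcdn g Om)) / 2.
have F0 := sqfree_harm_ge0 n.
apply: (Rle_trans _ (\sum_(1 <= g < M.+1 | (g %| M)%N)
   (INR n * sqfree_harm n * (/ INR g * tratio (M %/ g)) + INR n * (/ INR g * E g)))).
  apply: ler_sum => g; rewrite mem_index_iota => /andP[g0 _] gM.
  have g1 := INR_gt0 g0.
  have [j [g' [ja g'Om gE]]] := dvdn_pow2_mul oOm gM.
  have g'0 := dvdn_gt0 Om0 g'Om.
  have ow : odd (Om %/ g')%N.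
    by move: oOm; rewrite -{1}(divnK g'Om) oddM => /andP[].
  have qE : (M %/ g = 2 ^ (a - j) * (Om %/ g'))%N by rewrite gE pow2_mul_div.
  have EE : E g = INR (ndiv (Om %/ g')) / 2 by rewrite /E gE gcdn_pow2_mul.
  have E0 : 0 <= E g by rewrite EE; have := pos_INR (ndiv (Om %/ g')); lra.
  have t0 : 0 <= tratio (M %/ g).
    apply: Rmult_le_pos; first exact: pos_INR.
    by apply: inv_INR_ge0; rewrite divn_gt0 // dvdn_leq.
  have g20 : (0 < g ^ 2)%N by rewrite expn_gt0 g0.
  set N := (n %/ g ^ 2)%N.
  have Nn : INR N <= INR n / (INR g * INR g) by rewrite -INR_muln mulnn; exact: INR_divn.
  rewrite INR_muln INR_sum.
  apply: (Rle_trans _ (INR g * (tratio (M %/ g) * (INR n / (INR g * INR g)) * sqfree_harm n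
     + INR n / (INR g * INR g) * E g))); last by apply: Req_le; field; lra.
  apply: Rmult_le_compat_l; first lra.
  apply: (Rle_trans _ (\sum_(1 <= l < N.+1 | sqfree l)
     (tratio (M %/ g) * (INR n / (INR g * INR g)) * / INR l + E g))).
    apply: ler_sum => l; rewrite mem_index_iota => /andP[l0 _] _.
    have l1 := INR_gt0 l0.
    rewrite /N -divnMA qE EE; apply: Rle_trans (coprime_count_le _ _ ow _) _.
      by rewrite muln_gt0 g20.
    by apply: Req_le; rewrite INR_muln -mulnn INR_muln; field; lra.
  rewrite big_split -big_distrr; apply: Rplus_le_compat.
    apply: Rmult_le_compat_l; last exact/sqfree_harm_mono/leq_div.
    by apply: Rmult_le_pos => //; have := pos_INR N; lra.
  apply: Rle_trans (ler_sum_cond _ _) _; first by [].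
  by rewrite sum_const_nat; apply: Rmult_le_compat_r.
rewrite big_split -!big_distrr /= sum_tratio // Rmult_1_r.
have := sum_odd_ndiv_le a oOm; rewrite -/M => B.
have := Rmult_le_compat_l _ _ _ (Rlt_le _ _ n1) (sqfree_harm_le n0); rewrite -/al.
have : INR n * \sum_(1 <= g < M.+1 | (g %| M)%N) / INR g * E g <= INR n * weighted_ndiv Om.
  by apply: Rmult_le_compat_l; [lra|exact: B].
by lra.
Qed.

(** * The divisor sum *)


(** With [S n] the sum of the [r d], the left side minus [S n / n] grows by [S n / (n * (n + 1))]
    from [n] to [n + 1], at most [(al * ln n + C) / (n + 1)]; this is dominated by the growth of
    [al / 2 * ln ^ 2 + C * ln]. Restoring [S n / n] adds [al * ln n + C]. *)
Lemma abel_ln_bound (r : nat -> R) (al C : R) : 0 <= al -> 0 <= C ->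
  (forall n, (0 < n)%N ->
     \sum_(1 <= d < n.+1) r d <= INR n * (al * ln (INR n) + C)) ->
  forall n, (0 < n)%N -> \sum_(1 <= d < n.+1) / INR d * r d
    <= al / 2 * ln (INR n) ^ 2 + (al + C) * ln (INR n) + C.
Proof.
move=> al0 C0 H n n0; pose S m := \sum_(1 <= d < m.+1) r d.
suff : \sum_(1 <= d < n.+1) / INR d * r d - S n * / INR n
    <= al / 2 * ln (INR n) ^ 2 + C * ln (INR n).
  have n1 := INR_gt0 n0.
  have : S n * / INR n <= al * ln (INR n) + C.
    apply: (Rmult_le_reg_r (INR n)) => //.
    by rewrite Rmult_assoc Rinv_l; [have := H n n0; rewrite -/(S n); lra|lra].
  lra.
elim: n n0 => [//|n IH] _; have S1 := INR_gt0 (ltn0Sn n).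
have SE : S n.+1 = S n + r n.+1 by rewrite /S big_nat_recr.
have TE : \sum_(1 <= d < n.+2) / INR d * r d
  = \sum_(1 <= d < n.+1) / INR d * r d + / INR n.+1 * r n.+1 by rewrite big_nat_recr.
rewrite {}TE {}SE; case: (posnP n) => [n_eq0|n0].
  rewrite /S n_eq0 !big_geq // [INR 1]/= ln_1 Rinv_1 /=; lra.
have n1 := INR_ge1 n0; have l0 := ln_ge0 n1; have := IH n0.
have := lnS_sub_ge n0; have := H n n0; rewrite -/(S n).
move: (\sum_(1 <= d < n.+1) _) => T; move: (S n) (r n.+1) => s x.
move: (ln (INR n.+1)) l0 => l' l0.
have -> : INR n.+1 = INR n + 1 by exact: S_INR.
move: (ln (INR n)) l0 => l l0; move: (INR n) n1 => y y1 Hs Hl HT.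
have y2 : 0 < / (y + 1) by apply: Rinv_0_lt_compat; lra.
have -> : T + / (y + 1) * x - (s + x) * / (y + 1)
   = T - s * / y + s * (/ y * / (y + 1)) by field; lra.
have : s * (/ y * / (y + 1)) <= (al * l + C) * / (y + 1).
  rewrite -Rmult_assoc; apply: Rmult_le_compat_r; first lra.
  apply: (Rmult_le_reg_r y); first lra.
  by rewrite Rmult_assoc Rinv_l; lra.
have : al * l * / (y + 1) <= al / 2 * (l' ^ 2 - l ^ 2).
  have -> : al / 2 * (l' ^ 2 - l ^ 2) = al * ((l' - l) * ((l' + l) / 2)) by field.
  rewrite Rmult_assoc; apply: Rmult_le_compat_l => //.
  by rewrite Rmult_comm; apply: Rmult_le_compat; lra.
have : C * / (y + 1) <= C * (l' - l) by apply: Rmult_le_compat_l.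
lra.
Qed.

(** A divisor above [D] has a cofactor at most [D], so the small divisors and their cofactors cover
    all. *)
Lemma ndiv_le_small v D : (0 < v)%N -> (v < D.+1 * D.+1)%N ->
  (ndiv v <= 2 * \sum_(1 <= d < D.+1) (d %| v))%N.
Proof.
move=> v0 vD; rewrite ndivE sum_nat_of_bool mul2n -addnn.
set s := [seq d <- index_iota 1 D.+1 | _].
rewrite -{2}(size_map (divn v) s) -size_cat; apply: uniq_leq_size.
  exact/filter_uniq/iota_uniq.
move=> d; rewrite mem_filter mem_index_iota => /andP[dv /andP[d0 _]].
rewrite mem_cat; case: (leqP d D) => dD.
  by rewrite /s mem_filter mem_index_iota /= dv d0 ltnS dD.
apply/orP; right; apply/mapP; exists (v %/ d)%N; last by rewrite divn_divKn.
rewrite /s mem_filter mem_index_iota /= dvdn_divn // divn_gt0 // dvdn_leq //=.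
by rewrite ltn_divLR //; apply: leq_trans vD _; rewrite leq_mul2l dD orbT.
Qed.

(** After an exchange of sums, each [d <= D] counts roots modulo [d] in a window of length [L], at
    most [(L / d + 1) * rho M d] by periodicity. *)
Lemma sum_ndiv_le M u L D : (0 < u)%N ->
  (forall k, (k < L)%N -> ((u + k) * (u + k + M) < D.+1 * D.+1)%N) ->
  INR (\sum_(0 <= k < L) ndiv ((u + k) * (u + k + M)))%N
    <= 2 * (INR L * \sum_(1 <= d < D.+1) / INR d * INR (rho M d)
            + INR (\sum_(1 <= d < D.+1) rho M d)%N).
Proof.
move=> u0 H.
have : (\sum_(0 <= k < L) ndiv ((u + k) * (u + k + M))
    <= 2 * \sum_(1 <= d < D.+1) (L %/ d).+1 * rho M d)%N.
  apply: (@leq_trans (\sum_(0 <= k < L)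
     2 * \sum_(1 <= d < D.+1) (d %| (u + k) * (u + k + M)))%N).
    rewrite big_seq [X in (_ <= X)%N]big_seq; apply: leq_sum => k.
    rewrite mem_index_iota => /= kL; apply: ndiv_le_small; last exact: H.
    by rewrite muln_gt0 !addn_gt0 u0.
  rewrite -big_distrr /= leq_mul2l /= exchange_big /=.
  rewrite big_seq [X in (_ <= X)%N]big_seq; apply: leq_sum => d.
  rewrite mem_index_iota => /andP[d0 _].
  apply: (@sum_periodic_le d L u (fun k => d %| k * (k + M))%N d0) => k.
  by rewrite rho_periodic.
move=> /INR_leq h; apply: Rle_trans h _; rewrite INR_muln.
apply: Rmult_le_compat_l; first exact: pos_INR.
rewrite !INR_sum big_distrr -big_split; apply: ler_sum => d.
rewrite mem_index_iota => /andP[d0 _] _ /=.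
rewrite INR_muln S_INR; have := INR_divn L d0; have := pos_INR (rho M d).
move=> r0 Ld; have := Rmult_le_compat_r _ _ _ r0 Ld; rewrite /Rdiv; lra.
Qed.

(** * Comparison of the constant with C(Omega) *)

Definition inv_div_sum (n : nat) : R := \sum_(1 <= d < n.+1 | (d %| n)%N) / INR d.

Lemma inv_div_sum_mono m n : (0 < n)%N -> (m %| n)%N -> inv_div_sum m <= inv_div_sum n.
Proof.
move=> n0 mn; rewrite /inv_div_sum -big_filter -[X in _ <= X]big_filter.
apply: ler_sum_sub => [|d|d]; first exact/filter_uniq/iota_uniq.
  rewrite !mem_filter !mem_index_iota => /and3P[dm d0 _].
  have dn := dvdn_trans dm mn.
  by rewrite dn d0 ltnS dvdn_leq.
by rewrite mem_filter mem_index_iota => /and3P[_ d0 _]; exact: inv_INR_ge0.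
Qed.

Definition C_nat (Om : nat) : R :=
  2 * \sum_(1 <= d < Om.+1 | (d %| Om)%N)
    / INR d * (2 * INR (ndiv (Om %/ d)) - 1749 / 1000 * inv_div_sum (Om %/ d)
               + 1332 / 1000).

Lemma ndiv_gt0 n : (0 < n)%N -> (0 < ndiv n)%N.
Proof. by move=> n0; rewrite /ndiv big_mkcond big_nat_recr //= dvdnn addn1. Qed.

Lemma ndiv_gt1 n : (1 < n)%N -> (1 < ndiv n)%N.
Proof.
move=> n1; rewrite ndivE.
have : (size [:: 1%N; n] <= size [seq d <- index_iota 1 n.+1 | d %| n])%N => //.
apply: uniq_leq_size; first by rewrite /= inE andbT; lia.
move=> d; rewrite !inE => /orP[] /eqP ->; rewrite mem_filter mem_index_iota.
  by rewrite dvd1n; lia.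
by rewrite dvdnn; lia.
Qed.

(** For [Om = 1] the sides are 3.165 and 3.166. Otherwise [inv_div_sum] is at most 4 / 3 at every
    divisor and, as [1.749 * 4 / 3 = 2.332], each term of [C_nat Om - weighted_ndiv Om] is at least
    [(3 * ndiv (Om / g) - 2) / g]. These bounds are nonnegative, and the one for [g = 1] is already
    at least 4. *)
Lemma weighted_ndiv_lt_C (Om : nat) : (0 < Om)%N -> inv_div_sum Om <= 4 / 3 ->
  2165 / 1000 + weighted_ndiv Om < C_nat Om.
Proof.
move=> Om0 sig; case: (leqP Om 1) => [Om1|Om1].
  have -> : Om = 1%N by apply/eqP; rewrite eqn_leq Om1.
  have one (F : nat -> R) : \sum_(1 <= d < 2 | (d %| 1)%N) F d = F 1%N.
    by rewrite big_mkcond big_nat1.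
  have -> : C_nat 1 = 2 * (2 - 1749 / 1000 + 1332 / 1000).
    rewrite /C_nat one divn1 /inv_div_sum one /ndiv big_mkcond big_nat1 /=; field.
  by rewrite /weighted_ndiv one divn1 /ndiv big_mkcond big_nat1 /=; lra.
suff : 4 <= C_nat Om - weighted_ndiv Om by lra.
have n2 : 2 <= INR (ndiv Om).
  by rewrite (_ : 2 = INR 2) //; apply/INR_leq/ndiv_gt1.
have T g : (g %| Om)%N -> (0 < g)%N -> / INR g * (3 * INR (ndiv (Om %/ g)) - 2)
    <= 2 * (/ INR g * (2 * INR (ndiv (Om %/ g)) - 1749 / 1000 * inv_div_sum (Om %/ g)
               + 1332 / 1000)) - / INR g * INR (ndiv (Om %/ g)).
  move=> gOm g0; have := inv_div_sum_mono Om0 (dvdn_divn gOm); have := inv_INR_ge0 g0.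
  by nra.
apply: (Rle_trans _ (\sum_(1 <= g < Om.+1 | (g %| Om)%N)
    / INR g * (3 * INR (ndiv (Om %/ g)) - 2))).
  rewrite big_ltn_cond // dvd1n divn1 [INR 1]/= Rinv_1.
  have : 0 <= \sum_(2 <= g < Om.+1 | (g %| Om)%N) / INR g * (3 * INR (ndiv (Om %/ g)) - 2).
    apply: sum_ge0 => g; rewrite mem_index_iota => /andP[g1 _] gOm.
    have g0 := ltnW g1; apply: Rmult_le_pos; first exact: inv_INR_ge0.
    have : 1 <= INR (ndiv (Om %/ g)); last by lra.
    by apply/INR_ge1/ndiv_gt0; rewrite divn_gt0 // dvdn_leq.
  by move: (\sum_(2 <= _ < _ | _) _) => s s0 /=; lra.
suff : \sum_(1 <= g < Om.+1 | (g %| Om)%N) / INR g * (3 * INR (ndiv (Om %/ g)) - 2)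
    + weighted_ndiv Om <= C_nat Om by lra.
rewrite /C_nat /weighted_ndiv -big_split big_distrr; apply: ler_sum => g.
rewrite mem_index_iota => /andP[g0 _] gOm /=.
by have := T g gOm g0; lra.
Qed.

(** * Translation of the integer definitions to natural numbers *)

Lemma List_seq_iota m n : List.seq m n = iota m n.
Proof. by elim: n m => //= n IH m; rewrite IH. Qed.

Lemma fold_map_filter_nat (F : Z -> R) (P : Z -> bool) (s : list nat) :
  fold_right Rplus 0 (List.map F (List.filter P (List.map Z.of_nat s)))
  = \sum_(d <- s | P (Z.of_nat d)) F (Z.of_nat d).
Proof.
elim: s => [|d s IH]; first by rewrite big_nil.
by rewrite big_cons /=; case: ifP => _ /=; rewrite IH.
Qed.

Lemma Zmod_eqb_dvdn d n : (0 < d)%N ->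
  Z.eqb (Z.modulo (Z.of_nat n) (Z.of_nat d)) 0 = (d %| n)%N.
Proof.
move=> d0; apply/idP/idP.
  move=> /Z.eqb_eq/Z.mod_divide[|k kE]; first by lia.
  by apply/dvdnP; exists (Z.to_nat k); nia.
case/dvdnP => k ->; apply/Z.eqb_eq.
by rewrite (_ : Z.of_nat (k * d) = Z.of_nat k * Z.of_nat d)%Z ?Z.mod_mul; lia.
Qed.

Lemma fold_divs (F : Z -> R) n :
  fold_right Rplus 0 (List.map F (divs (Z.of_nat n)))
  = \sum_(1 <= d < n.+1 | (d %| n)%N) F (Z.of_nat d).
Proof.
rewrite /divs fold_map_filter_nat List_seq_iota Nat2Z.id.
rewrite /index_iota subn1 big_seq_cond [RHS]big_seq_cond; apply: eq_bigl => d.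
by rewrite mem_iota; case: (posnP d) => [->|d0] //=; rewrite Zmod_eqb_dvdn.
Qed.

Lemma length_divs n : length (divs (Z.of_nat n)) = ndiv n.
Proof.
apply: INR_eq; rewrite /ndiv INR_sum -(fold_divs (fun=> 1)).
by elim: (divs _) => // x s IH; rewrite [length _]/= S_INR IH /=; lra.
Qed.

Lemma sigma0_nat n : sigma0 (Z.of_nat n) = INR (ndiv n).
Proof. by rewrite /sigma0 length_divs. Qed.

Lemma sigma_m1_nat n : sigma_m1 (Z.of_nat n) = inv_div_sum n.
Proof.
rewrite /sigma_m1 fold_divs; apply: eq_bigr => d _; by rewrite -INR_IZR_INZ.
Qed.

Lemma C_Omega_nat n : C_Omega (Z.of_nat n) = C_nat n.
Proof.
rewrite /C_Omega fold_divs /C_nat; congr (_ * _).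
rewrite big_seq_cond [RHS]big_seq_cond; apply: eq_bigr => d.
rewrite mem_index_iota => /andP[/andP[d0 _] dn].
have -> : (Z.of_nat n / Z.of_nat d)%Z = Z.of_nat (n %/ d).
  rewrite -{1}(divnK dn) (_ : Z.of_nat (_ * d) = Z.of_nat (n %/ d) * Z.of_nat d)%Z; last lia.
  by rewrite Z.div_mul; lia.
by rewrite -INR_IZR_INZ sigma0_nat sigma_m1_nat.
Qed.

Lemma Zsum_nat a N g :
  Zsum a N g = (\sum_(0 <= k < Z.to_nat (N - a + 1)) g (a + Z.of_nat k)%Z)%N.
Proof.
rewrite /Zsum List_seq_iota /index_iota subn0.
elim: (iota _ _) => [|k s IH]; first by rewrite big_nil.
by rewrite big_cons -IH.
Qed.

Lemma Z_of_nat_muln m n : Z.of_nat (m * n)%N = (Z.of_nat m * Z.of_nat n)%Z.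
Proof. by lia. Qed.

Lemma Z_sqr_inj_nonneg (x y : Z) : (0 <= x)%Z -> (0 <= y)%Z -> (x ^ 2 = y ^ 2)%Z -> x = y.
Proof. by move=> x0 y0; nia. Qed.

Theorem theorem3 (b c t Om N : Z)
  (hbc : (b < c)%Z)
  (hpar : Z.Even (c - b))
  (ht0 : (0 <= t)%Z) (ht : Z.Even t)
  (hOm1 : (1 <= Om)%Z) (hOm : Z.Odd Om)
  (hdelta : ((c - b) ^ 2 = 4 * (2 ^ t * Om ^ 2))%Z)
  (hsig : sigma_m1 Om <= 4 / 3)
  (hN : (Z.max 1 (c + 1) <= N)%Z) :
  let cs := Z.max 1 (c + 1) in
  let X := sqrt (IZR ((N - b) * (N - c))) in
  INR (Zsum cs N (fun n => tau ((n - b) * (n - c))))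
  < 2 * IZR N * (3 / PI ^ 2 * ln X ^ 2 + (6 / PI ^ 2 + C_Omega Om) * ln X + C_Omega Om)
    + 2 * X * (6 / PI ^ 2 * ln X + C_Omega Om).
Proof.
move=> cs X.
have [s tE] := ht.
have s0 : (0 <= s)%Z by lia.
pose O := Z.to_nat Om; have OE : Om = Z.of_nat O by lia.
(* Since [t = 2 * s], [hdelta] gives [c - b = 2 ^ (s + 1) * Om]. *)
pose a := (Z.to_nat s).+1; pose M := (2 ^ a * O)%N.
have oO : odd O.
  by case: hOm => k kE; rewrite (_ : O = (Z.to_nat k).*2.+1) /= ?odd_double //; lia.
have O0 : (0 < O)%N by lia.
have pow2 m : Z.of_nat (2 ^ m)%N = (2 ^ Z.of_nat m)%Z.
  elim: m => // m IH; rewrite expnS Nat2Z.inj_succ Z.pow_succ_r; last lia.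
  by rewrite -IH; lia.
have ME : (c - b = Z.of_nat M)%Z.
  have -> : Z.of_nat M = (2 ^ (s + 1) * Om)%Z.
    rewrite /M (_ : Z.of_nat (_ * _) = Z.of_nat (2 ^ a) * Z.of_nat O)%Z; last lia.
    by rewrite pow2 -OE; congr (2 ^ _ * _)%Z; rewrite /a; lia.
  apply: Z_sqr_inj_nonneg; [lia|have := Z.pow_nonneg 2 (s + 1); nia|].
  rewrite hdelta Z.pow_mul_l -Z.pow_mul_r; try lia.
  rewrite (_ : (s + 1) * 2 = t + 2)%Z; last lia.
  by rewrite Z.pow_add_r; lia.
(* With [n = cs + k], the factors [n - c = u + k] and [n - b = u + k + M] are positive because
   [cs > c]. *)
pose u := Z.to_nat (cs - c); pose L := Z.to_nat (N - cs + 1).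
pose U := Z.to_nat (N - c); pose V := (U * (U + M))%N.
have u0 : (0 < u)%N by lia.
have U0 : (0 < U)%N by lia.
have M0 : (0 < M)%N by rewrite muln_gt0 expn_gt0.
have VE : ((N - b) * (N - c) = Z.of_nat V)%Z by rewrite /V Z_of_nat_muln; have -> : (N - b = Z.of_nat (U + M)%N)%Z; lia.
have -> : Zsum cs N (fun n => tau ((n - b) * (n - c)))
    = (\sum_(0 <= k < L) ndiv ((u + k) * (u + k + M)))%N.
  rewrite Zsum_nat; apply: eq_bigr => k _.
  rewrite /tau -length_divs; congr (length (divs _)).
  have -> : (cs + Z.of_nat k - c = Z.of_nat (u + k)%N)%Z by lia.
  have -> : (cs + Z.of_nat k - b = Z.of_nat (u + k + M)%N)%Z by lia.
  by rewrite -Z_of_nat_muln mulnC Z.abs_eq //; exact: Nat2Z.is_nonneg.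
(* The floor of [X]; the pairing of divisors rests on [V < (D + 1) ^ 2]. *)
pose D := Nat.sqrt V.
have [/leP DV /leP VD] := Nat.sqrt_spec V (Nat.le_0_l V).
have V0 : (0 < V)%N by rewrite muln_gt0 U0 addn_gt0 U0.
have D0 : (0 < D)%N by rewrite lt0n; apply: contraTN VD => /eqP; rewrite -/D => ->; lia.
have DX : INR D <= X.
  rewrite /X VE -INR_IZR_INZ -(sqrt_square (INR D)); last exact: pos_INR.
  by apply: sqrt_le_1_alt; rewrite -INR_muln; exact: INR_leq.
have D1 := INR_ge1 D0.
have lD := ln_ge0 D1.
have lX : ln (INR D) <= ln X by apply: ln_le_mono; lra.
rewrite OE C_Omega_nat; rewrite OE sigma_m1_nat in hsig.
set K := 2165 / 1000 + weighted_ndiv O.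
have KC : K < C_nat O := weighted_ndiv_lt_C O0 hsig.
have Z0 : 0 <= weighted_ndiv O.
  apply: sum_ge0 => g; rewrite mem_index_iota => /andP[g0 _] _.
  by apply: Rmult_le_pos; [exact: inv_INR_ge0|exact: pos_INR].
have K0 : 0 <= K by rewrite /K; lra.
set al := 6 / PI ^ 2.
have -> : 3 / PI ^ 2 = al / 2 by rewrite /al; field; have := PI_RGT_0; lra.
have al0 : 0 <= al.
  by apply/Rlt_le/Rdiv_lt_0_compat; [lra|have := PI_RGT_0; nra].
have LN : INR L <= IZR N.
  by rewrite INR_IZR_INZ; apply: IZR_le; lia.
have S n : (0 < n)%N -> \sum_(1 <= d < n.+1) INR (rho M d)
    <= INR n * (al * ln (INR n) + K).
  by move=> n0; rewrite -INR_sum; exact: sum_rho_bound.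
have S1 := S D D0; have S2 := abel_ln_bound al0 K0 S D0.
have bnd k : (k < L)%N -> ((u + k) * (u + k + M) < D.+1 * D.+1)%N.
  move=> kL; apply: leq_ltn_trans VD; rewrite /V; apply: leq_mul; lia.
have := sum_ndiv_le u0 bnd; rewrite (INR_sum (index_iota 1 D.+1)).
have N0 : 0 < IZR N by apply: IZR_lt; lia.
move: {S} (\sum_(1 <= d < D.+1) INR (rho M d)) S1 => A S1.
move: (\sum_(1 <= d < D.+1) / INR d * INR (rho M d)) S2 => B S2 H.
apply: Rle_lt_trans H _.
move: KC lX lD S1 S2.
move: (C_nat O) (ln X) (ln (INR D)) => C x l KC lX lD S1 S2.
set P := al / 2 * l ^ 2 + (al + K) * l + K in S2.
have P0 : 0 <= P by rewrite /P; nra.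
have lx : al * l <= al * x by exact: Rmult_le_compat_l.
(* Strictness comes from the last constant, [K < C], and survives multiplication by [N > 0]; the
   terms in [D] and [X] are compared non-strictly. *)
have Q0 : P < al / 2 * x ^ 2 + (al + C) * x + C.
  have : al / 2 * l ^ 2 <= al / 2 * x ^ 2.
    by apply: Rmult_le_compat_l; [lra|apply: pow_incr].
  have : (al + K) * l <= (al + C) * x by apply: Rmult_le_compat; lra.
  by rewrite /P; lra.
have LB : INR L * B <= IZR N * P.
  apply: (Rle_trans _ (INR L * P)); first by apply: Rmult_le_compat_l => //; exact: pos_INR.
  exact: Rmult_le_compat_r.
have NP : IZR N * P < IZR N * (al / 2 * x ^ 2 + (al + C) * x + C).
  exact: Rmult_lt_compat_l.
have : INR D * (al * l + K) <= X * (al * x + C).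
  have : 0 <= al * l by exact: Rmult_le_pos.
  by move=> ?; apply: Rmult_le_compat; lra.
lra.
Qed.
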